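(* Let $(S,\omega)$ be a compact symplectic manifold and $h$ a symplectomorphism of $(S,\omega)$. Suppose that $\omega$ is exact and that the flux of $h$ is nonzero. Then the class $[\omega_h]$ is nonzero in $H^2(\Sigma(S,h);\mathbb{R})$. Hence $h$ cannot be realized as the first return map of a Reeb vector field $R_\alpha$.
   Context: Mapping torus. $\Sigma(S,h)=(S\times[0,1])/(x,1)\sim(h(x),0)$, with coordinates $(x,t)$ on $S\times[0,1]$ (smooth structure: the quotient of $S\times\mathbb{R}$ by $(x,t)\mapsto(h(x),t-1)$). The form $\omega_h$. $\omega_h$ is the closed 2-form on $\Sigma(S,h)$ obtained from the pullback of $\omega$ to $S\times[0,1]$ by identifying via the symplectomorphism $h$; it restricts to $\omega$ on each $S\times\{t\}$ and its kernel is directed by $\partial_t$. First return map of a Reeb vector field. One says that $h$ is the first return map of a Reeb vector field $R_\alpha$ if there is a contact form $\alpha$ on $\Sigma(S,h)$ with $d\alpha|_{S\times\{0\}}=\omega$ whose Reeb vector field $R_\alpha$ is directed by $\partial_t$, i.e. $R_\alpha=g\,\partial_t$ for a positive function $g$. Flux. Let $K=\ker(h_*-\mathrm{id}:H_1(S;\mathbb{Z})\to H_1(S;\mathbb{Z}))$ and let $\Gamma\subset\mathbb{R}$ be the subgroup generated by the numbers $\int_\Sigma\omega$, $[\Sigma]\in H_2(S;\mathbb{Z})$ (so $\Gamma=0$ when $\omega$ is exact). For $[\gamma]\in K$ choose an oriented singular cobordism (2-chain) $C$ in $S$ with $\partial C=h(\gamma)-\gamma$ and put $F_h([\gamma])=\int_C\omega\in\mathbb{R}/\Gamma$;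 this is well defined and depends only on $[\gamma]$. The flux of $h$ is nonzero if $F_h:K\to\mathbb{R}/\Gamma$ is not identically $[0]$. The manifold $S$ may have boundary. *)

(* Defs.v *)
From HB Require Import structures.
From mathcomp Require Import all_boot all_order all_algebra all_fingroup.
From mathcomp Require Import generic_quotient.
From mathcomp Require Import all_classical all_reals all_analysis.
From mathcomp.multinomials Require Import freeg.

Set Implicit Arguments.
Unset Strict Implicit.
Unset Printing Implicit Defensive.

Import Order.TTheory GRing.Theory Num.Theory numFieldNormedType.Exports.

Local Open Scope classical_set_scope.
Local Open Scope ring_scope.

Section Smooth.
Context {R : realType} {V W : normedModType R}.

Fixpoint is_Ck (k : nat) (O : set V) (f : V -> W) : Prop :=
  if k is k'.+1 then
    (forall x, O x -> differentiable f x) /\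
    (forall v, is_Ck k' O (fun x => 'D_v f x))
  else forall x, O x -> {for x, continuous f}.

Definition is_Cinfty (O : set V) (f : V -> W) : Prop :=
  forall k, is_Ck k O f.

(* [A] is an arbitrary subset, in practice a relatively open part of a
   half-space or a simplex. *)
Definition smooth_extension (A : set V) (f : V -> W) (x : V) (g : V -> W) :=
  exists O : set V, [/\ open O, O x, is_Cinfty O g &
    forall y, O y -> A y -> g y = f y].

Definition smooth_within (A : set V) (f : V -> W) : Prop :=
  forall x, A x -> exists g, smooth_extension A f x g.

(* The derivative along [v] of any smooth extension.  When [A] lies in the
   closure of its interior it does not depend on the extension, so that it
   makes sense at boundary points of a half-space. *)
Definition derive_within (A : set V) (f : V -> W) (x v : V) : W :=
  get [set y | exists2 g, smooth_extension A f x g & y = 'D_v g x].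

End Smooth.

(* An atlas of local parametrizations, i.e. of inverses of charts.  The value
   of [par i] outside [pdom i] is irrelevant. *)
Record atlas (R : realType) (n : nat) (M : Type) := Atlas {
  pidx : Type;
  pdom : pidx -> set 'rV[R]_n;
  par : pidx -> 'rV[R]_n -> M
}.

Section Manifold.
Context {R : realType}.

Definition par_on n M (A : atlas R n M) (i : pidx A) (x : pdom i) : M :=
  par i (\val x).
Arguments par_on {n M A} i x.

(* [u] is a smooth local expression of [f] near [x] in the chart [j]. *)
Definition local_expr k n M (A : atlas R n M) (D : set 'rV[R]_k) (f : D -> M)
    (x : 'rV[R]_k) (j : pidx A) (u : 'rV[R]_k -> 'rV[R]_n) : Prop :=
  exists O : set 'rV[R]_k, [/\ open O, O x, is_Cinfty O u &
    forall y : D, O (\val y) ->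
      pdom j (u (\val y)) /\ par j (u (\val y)) = f y].

Definition smooth_into k n M (A : atlas R n M) (D : set 'rV[R]_k)
    (f : D -> M) : Prop :=
  forall x, D x -> exists (j : pidx A) u, local_expr f x j u.

Definition smooth_map n M (A : atlas R n M) p N (B : atlas R p N)
    (f : M -> N) : Prop :=
  forall i : pidx A, smooth_into B (f \o par_on i).

Definition half_space n : set 'rV[R]_n :=
  [set x | forall i : 'I_n, i = 0 :> nat -> 0 <= x 0 i].
Arguments half_space n x : clear implicits.

Definition manifold_with_boundary n (M : topologicalType)
    (A : atlas R n M) : Prop :=
  [/\ hausdorff_space M /\ @second_countable M,
      (forall i : pidx A, exists2 O : set 'rV[R]_n,
         open O & pdom i = O \/ pdom i = O `&` half_space n),
      (forall p : M, exists (i : pidx A) x, pdom i x /\ par i x = p),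
      (forall i : pidx A,
         [/\ (forall x y, pdom i x -> pdom i y -> par i x = par i y -> x = y),
             {within pdom i, continuous (par i)} &
             forall O : set 'rV[R]_n, open O -> open (par i @` (pdom i `&` O))]) &
      (forall (i j : pidx A) x y, pdom i x -> pdom j y -> par i x = par j y ->
         exists u, local_expr (par_on i) x j u)].

End Manifold.
Arguments par_on {R n M A} i x.

Section Forms.
Context {R : realType} {n : nat} {M : Type} (A : atlas R n M).

(* A form is given by its coefficients in each chart: in the chart [i], at the
   point of coordinates [x],
     a(v)    = v *m a i x            for a 1-form,
     w(v, v') = v *m w i x *m v'^T   for a 2-form,
   tangent vectors being rows.  Only the values at [x] in [pdom i] matter. *)
Definition pre_form1 := pidx A -> 'rV[R]_n -> 'cV[R]_n.
Definition pre_form2 := pidx A -> 'rV[R]_n -> 'M[R]_n.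
Definition pre_vfield := pidx A -> 'rV[R]_n -> 'rV[R]_n.

(* [jacobian u x] is the matrix of the differential of [u] acting on rows. *)
Definition is_form1 (a : pre_form1) : Prop :=
  (forall i, smooth_within (pdom i) (a i)) /\
  (forall i x j u, pdom i x -> local_expr (par_on i) x j u ->
     a i x = jacobian u x *m a j (u x)).

Definition is_form2 (w : pre_form2) : Prop :=
  [/\ (forall i, smooth_within (pdom i) (w i)),
      (forall i x, pdom i x -> (w i x)^T = - w i x) &
      (forall i x j u, pdom i x -> local_expr (par_on i) x j u ->
         w i x = jacobian u x *m w j (u x) *m (jacobian u x)^T)].

Definition is_vfield (X : pre_vfield) : Prop :=
  (forall i, smooth_within (pdom i) (X i)) /\
  (forall i x j u, pdom i x -> local_expr (par_on i) x j u ->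
     X j (u x) = X i x *m jacobian u x).

Definition pullback2 k (D : set 'rV[R]_k) (f : D -> M) (w : pre_form2)
    (x : 'rV[R]_k) : 'M[R]_k :=
  get [set B | exists (j : pidx A) u, local_expr f x j u /\
                 B = jacobian u x *m w j (u x) *m (jacobian u x)^T].

Definition ext_d1 (a : pre_form1) : pre_form2 := fun i x =>
  \matrix_(k, l) (derive_within (pdom i) (fun y => a i y l 0) x (delta_mx 0 k)
                - derive_within (pdom i) (fun y => a i y k 0) x (delta_mx 0 l)).

Definition is_closed2 (w : pre_form2) : Prop :=
  forall i x (k l m : 'I_n), pdom i x ->
    derive_within (pdom i) (fun y => w i y l m) x (delta_mx 0 k)
  + derive_within (pdom i) (fun y => w i y m k) x (delta_mx 0 l)
  + derive_within (pdom i) (fun y => w i y k l) x (delta_mx 0 m) = 0.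

Definition is_exact2 (w : pre_form2) : Prop :=
  exists2 a, is_form1 a & forall i x, pdom i x -> w i x = ext_d1 a i x.

(* The de Rham class of [w], as a coset of the exact forms. *)
Definition deRham_class (w : pre_form2) : set pre_form2 :=
  [set w' | [/\ is_form2 w', is_closed2 w' &
                is_exact2 (fun i x => w' i x - w i x)]].

Definition deRham_zero : set pre_form2 := deRham_class (fun _ _ => 0).

Definition symplectic (w : pre_form2) : Prop :=
  [/\ is_form2 w, is_closed2 w & forall i x, pdom i x -> w i x \in unitmx].

Definition symplectomorphism (w : pre_form2) (h : M -> M) : Prop :=
  [/\ smooth_map A A h,
      (exists g, [/\ cancel h g, cancel g h & smooth_map A A g]) &
      forall i x, pdom i x -> pullback2 (h \o par_on i) w x = w i x].

End Forms.
Arguments deRham_zero {R n M} A _.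

Section Contact.
Context {R : realType} {m : nat} {M : Type} (A : atlas R m.*2.+1 M).

(* The value of a /\ b^m on the standard basis, up to the positive factor
   coming from the normalization of the wedge product. *)
Definition wedge_top (a : 'cV[R]_(m.*2.+1)) (b : 'M[R]_(m.*2.+1)) : R :=
  \sum_(s : 'S_(m.*2.+1)) (-1) ^+ s * (a (s ord0) 0 *
    \prod_(k < m) b (s (inord k.*2.+1)) (s (inord k.*2.+2))).

Definition contact_form (a : pre_form1 A) : Prop :=
  is_form1 a /\
  forall i x, pdom i x -> wedge_top (a i x) (ext_d1 a i x) != 0.

Definition reeb_field (a : pre_form1 A) (X : pre_vfield A) : Prop :=
  is_vfield X /\
  forall i x, pdom i x ->
    X i x *m a i x = 1%:M /\ X i x *m ext_d1 a i x = 0.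

End Contact.

Section Chains.
Context {R : realType}.

Definition std_simplex k : set 'rV[R]_k :=
  [set x | (forall i, 0 <= x 0 i) /\ \sum_i x 0 i <= 1].
Arguments std_simplex k x : clear implicits.

Definition vertex k (j : 'I_k.+1) : 'rV[R]_k :=
  if unlift ord0 j is Some l then delta_mx 0 l else 0.

Definition bary k (x : 'rV[R]_k) (j : 'I_k.+1) : R :=
  if unlift ord0 j is Some l then x 0 l else 1 - \sum_l x 0 l.

(* The affine map that sends the vertices of the standard simplex, in order, to
   the vertices of the next one other than the [i]-th. *)
Definition face_pt k (i : 'I_k.+2) (x : 'rV[R]_k) : 'rV[R]_k.+1 :=
  \sum_(j < k.+1) bary x j *: vertex (fintype.lift i j).

Lemma bary_ge0 k (x : 'rV[R]_k) j : std_simplex k x -> 0 <= bary x j.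
Proof.
move=> [x0 x1]; rewrite /bary; case: unlift => [l|]; first exact: x0.
by rewrite subr_ge0.
Qed.

Lemma sum_bary k (x : 'rV[R]_k) : \sum_j bary x j = 1.
Proof.
rewrite big_ord_recl {1}/bary unlift_none.
rewrite [X in _ + X](eq_bigr (x 0)) ?subrK // => l _.
by rewrite /bary liftK.
Qed.

Lemma vertex_ge0 k (j : 'I_k.+1) l : 0 <= vertex j 0 l.
Proof. by rewrite /vertex; case: unlift => [q|]; rewrite mxE // ler0n. Qed.

Lemma sum_vertex_le1 k (j : 'I_k.+1) : \sum_l vertex j 0 l <= 1.
Proof.
rewrite /vertex; case: unlift => [q|].
  rewrite (bigD1 q) //= mxE !eqxx big1 ?addr0 // => l lq.
  by rewrite mxE (negPf lq).
by rewrite big1 // => l _; rewrite mxE.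
Qed.

Lemma face_ptP k (i : 'I_k.+2) (x : std_simplex k) :
  face_pt i (\val x) \in std_simplex k.+1.
Proof.
have xD : std_simplex k (\val x) by exact: set_valP.
rewrite inE; split=> [l|].
  rewrite summxE sumr_ge0 // => j _.
  by rewrite mxE mulr_ge0 ?bary_ge0 ?vertex_ge0.
under eq_bigr do rewrite summxE.
rewrite exchange_big /= -[leRHS](sum_bary (\val x)) ler_sum // => j _.
under eq_bigr do rewrite mxE.
by rewrite -mulr_sumr ler_piMr ?bary_ge0 ?sum_vertex_le1.
Qed.

Definition face k (i : 'I_k.+2) (x : std_simplex k) : std_simplex k.+1 :=
  exist _ (face_pt i (\val x)) (face_ptP i x).

Section InManifold.
Context {n : nat} {M : topologicalType} (A : atlas R n M).

Definition chain k := {freeg (std_simplex k -> M)}.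

Definition chain_sum k (V : zmodType) (c : chain k)
    (F : (std_simplex k -> M) -> V) : V :=
  \sum_(s <- dom c) F s *~ coeff s c.

Definition bnd k (c : chain k.+1) : chain k :=
  chain_sum c (fun s => \sum_(i < k.+2) << s \o face i >> *~ (-1) ^+ i).

Definition push k (h : M -> M) (c : chain k) : chain k :=
  chain_sum c (fun s => << h \o s >>).

Definition smooth_chain k (c : chain k) : Prop :=
  forall s, s \in dom c -> smooth_into A s.

Definition smooth_cycle k (c : chain k.+1) : Prop :=
  smooth_chain c /\ bnd c = 0.

Definition plane_pt (p : R * R) : 'rV[R]_2 :=
  \row_j (if j == ord0 then p.1 else p.2).

Definition int_simplex (w : pre_form2 A) (s : std_simplex 2 -> M) : R :=
  Rintegral (lebesgue_measure \x lebesgue_measure)%E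
    (plane_pt @^-1` std_simplex 2)
    (fun p => pullback2 s w (plane_pt p) ord0 ord_max).

Definition int_chain (w : pre_form2 A) (c : chain 2) : R :=
  chain_sum c (int_simplex w).

Definition subgroup (H : set R) : Prop :=
  H 0 /\ (forall x y, H x -> H y -> H (x - y)).

Definition periods (w : pre_form2 A) : set R :=
  smallest subgroup [set int_chain w c | c in [set c | smooth_cycle c]].

(* Smooth 1-cycles whose class lies in the kernel of h_* - id on H_1. *)
Definition ker_cycle (h : M -> M) (c : chain 1) : Prop :=
  smooth_cycle c /\
  exists2 C : chain 2, smooth_chain C & bnd C = push h c - c.

(* F_h([c]) in R / Gamma, as a coset of Gamma. *)
Definition flux (w : pre_form2 A) (h : M -> M) (c : chain 1) : set R :=
  [set r | exists C : chain 2, [/\ smooth_chain C, bnd C = push h c - c &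
                                   periods w (r - int_chain w C)]].

Definition flux_nonzero (w : pre_form2 A) (h : M -> M) : Prop :=
  exists2 c : chain 1, ker_cycle h c & flux w h c <> periods w.

End InManifold.
End Chains.

Section MappingTorus.
Context {R : realType} {S : topologicalType} (h : S -> S).
Local Open Scope quotient_scope.

Definition deck (p : S * R) : S * R := (h p.1, p.2 - 1).

(* The equivalence relation generated by p ~ deck p. *)
Definition torus_rel (p q : S * R) : bool :=
  `[< exists a b : nat, iter a deck p = iter b deck q >].

Lemma torus_rel_equiv : equiv_class_of torus_rel.
Proof.
split=> [p|p q|q p r].
- by apply/asboolP; exists 0%N, 0%N.
- by apply/asbool_equiv_eq; split=> -[a [b e]]; exists b, a.
- move=> /asboolP[a [b e1]] /asboolP[c [d e2]]; apply/asboolP.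
  by exists (c + a)%N, (b + d)%N; rewrite !iterD e1 -e2 -!iterD addnC.
Qed.

Canonical torus_equiv : equiv_rel (S * R)%type := EquivRelPack torus_rel_equiv.

Definition mapping_torus : Type := quotient_topology {eq_quot torus_equiv}.
HB.instance Definition _ := Topological.on mapping_torus.
HB.instance Definition _ := Quotient.on mapping_torus.

Definition torus_pi (p : S * R) : mapping_torus := \pi_mapping_torus p.

Context {n : nat} (A : atlas R n S).

(* A chart [i] of S times an open interval ]a, a + 1[, on which the quotient
   map is injective; the coordinate [t] comes first. *)
Definition torus_atlas : atlas R (1 + n) mapping_torus :=
  @Atlas R (1 + n) mapping_torus (pidx A * R)%type
    (fun ia => [set y : 'rV_(1 + n) | pdom ia.1 (rsubmx y) /\
                                      ia.2 < lsubmx y 0 0 < ia.2 + 1])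
    (fun ia (y : 'rV_(1 + n)) => torus_pi (par ia.1 (rsubmx y), lsubmx y 0 0)).

Definition omega_torus (w : pre_form2 A) : pre_form2 torus_atlas :=
  fun ia (y : 'rV_(1 + n)) => block_mx 0 0 0 (w ia.1 (rsubmx y)).

Definition d_dt : pre_vfield torus_atlas := fun _ _ => row_mx 1%:M 0.

End MappingTorus.
Arguments omega_torus {R S} h {n A} w _ _.

Definition first_return_of_reeb (R : realType) (m : nat) (S : topologicalType)
    (A : atlas R m.*2 S) (w : pre_form2 A) (h : S -> S) : Prop :=
  exists (alpha : pre_form1 (torus_atlas h A : atlas R m.*2.+1 _))
         (X : pre_vfield (torus_atlas h A : atlas R m.*2.+1 _)),
    [/\ contact_form alpha,
        (forall (i : pidx A) x, pdom i x ->
           pullback2 (fun y => torus_pi h (par_on i y, 0)) (ext_d1 alpha) x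
           = w i x),
        reeb_field alpha X &
        exists2 g : mapping_torus h -> R, (forall p, 0 < g p) &
          forall i x, pdom i x -> X i x = g (par i x) *: d_dt i x].

(* Main.v *)
Require Import Defs.
From HB Require Import structures.
From mathcomp.multinomials Require Import freeg.
From mathcomp Require Import all_boot all_order all_algebra.
From mathcomp Require Import generic_quotient.
From mathcomp Require Import all_classical all_reals all_analysis.
From mathcomp Require Import ring lra.
From mathcomp Require Import measurable_realfun unstable.

(** Both assertions come down to one statement: if the mapping torus carries
    a one-form beta such that d beta has no component along dt and restricts,
    on the slice S x {0}, to e w for a constant e <> 0, then the flux of h
    vanishes.  Equality of the class of omega_h with the zero class gives such
    a form with e = -1, because the zero form then differs from omega_h by an
    exact form.  A contact form alpha whose Reeb field is g d/dt gives one with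
    e = 1: the Reeb field lies in the kernel of d alpha, and g > 0.

    Write beta_t for the restriction of beta to S x {t} and beta(d/dt) for its
    vertical component.  The absence of a dt component in d beta says that the
    derivative of beta_t in t is the differential of the function beta(d/dt)
    on S.  Hence beta_1 - beta_0 = dF, where F(p) is the integral of beta over
    the vertical segment {p} x [0, 1].  On the other hand (p, 1) is identified
    with (h(p), 0), so that beta_1 is the pull-back of beta_0 by h.  If c is a
    one-cycle and C a two-chain of boundary h(c) - c, Stokes' formula yields
      e int_C w = int_h(c) beta_0 - int_c beta_0
                = int_c beta_1 - int_c beta_0 = int_c dF = 0.
    Every integral that enters the flux is thus zero ([flux_integral_eq0] and
    [flux_eq0_of_primitive]).

    The function F need not be differentiated.  For a singular edge s, the
    strip s x [0, 1] is cut into two singular triangles of S x R, on which the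
    pull-back of d beta vanishes for reasons of rank ([pullback2_prism]);
    Stokes' formula for these triangles gives
      int_s beta_1 - int_s beta_0 = F(end of s) - F(start of s)
    ([level_homotopy]), and the right-hand sides cancel along a cycle.  So all
    the analysis is in Stokes' formula for one singular triangle ([stokes]).
    It follows from Green's formula on the standard triangle
    ([green_triangle], by Fubini's theorem and the fundamental theorem of
    calculus on each slice) and from the commutation of d with pull-backs
    ([curl_pullback], by the symmetry of second derivatives [derive_comm]).

    As S may have a boundary, charts and simplices have boundary points, where
    derivatives are those of smooth extensions.  They do not depend on the
    extension because these domains lie in the closure of their interior
    ([regular_dom]). *)

Set Implicit Arguments.
Unset Strict Implicit.
Unset Printing Implicit Defensive.

Import Order.TTheory GRing.Theory Num.Theory numFieldNormedType.Exports.

Local Open Scope classical_set_scope.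
Local Open Scope ring_scope.

(** * Calculus of maps of class C^k *)

Section Calculus.
Context {R : realType}.

Lemma differentiable_near_eq (V W : normedModType R) (f g : V -> W) x :
  (\near x, f x = g x) -> differentiable f x -> differentiable g x.
Proof.
move=> fg df.
have e0 : \forall h \near (0 : V), (g \- f) (h + x) = 0.
  have : \near x, (g \- f) x = 0.
    by apply: filterS fg => y fgy /=; rewrite fgy subrr.
  rewrite (near_shift 0 x); apply: filterS => h /=.
  by rewrite subr0.
have -> : g = f + (g - f) by apply/funext => y; rewrite !fctE addrC subrK.
apply: differentiableD => //.
pose z : {linear V -> W} := GRing.null_fun W.
have eo : (g - f) \o shift x = cst ((g - f) x) + z +o_ 0 id.
  apply/eqaddoP => _/posnumP[eps]; near=> h.
  have -> : ((g - f) \o shift x - (cst ((g - f) x) + z)) h = 0.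
    have := nbhs_singleton e0; rewrite /= add0r => e0'.
    by rewrite !fctE /= e0' addr0 subr0; near: h; exact: e0.
  by rewrite normr0 mulr_ge0.
have zc : continuous z by move=> y; exact: cvg_cst.
by apply/diff_locallyP; rewrite (diff_unique zc eo).
Unshelve. all: by end_near. Qed.

Implicit Types V W : normedModType R.

Lemma is_Ck_sub k V W (O O' : set V) (f : V -> W) :
  O' `<=` O -> is_Ck k O f -> is_Ck k O' f.
Proof.
move=> sO; elim: k f => [|k IH] f /=; first by move=> cf x /sO; exact: cf.
by move=> [df cf]; split=> [x /sO|v]; [exact: df|exact: IH (cf v)].
Qed.

Lemma is_Ck_ext k V W (O : set V) (f g : V -> W) : open O ->
  (forall x, O x -> f x = g x) -> is_Ck k O f -> is_Ck k O g.
Proof.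
move=> oO; elim: k f g => [|k IH] f g fg /=.
  move=> cf x Ox.
  have nfg : \forall y \near x, f y = g y.
    by apply: filterS (open_nbhs_nbhs (conj oO Ox)) => y; exact: fg.
  suff : g @ x --> f x by rewrite fg.
  apply: cvg_trans (cf x Ox); apply: near_eq_cvg.
  by apply: filterS nfg => y ->.
have nfg x : O x -> \forall y \near x, f y = g y.
  by move=> Ox; apply: filterS (open_nbhs_nbhs (conj oO Ox)) => y; exact: fg.
move=> [df cf]; split=> [x Ox|v].
  by apply: differentiable_near_eq (nfg x Ox) (df x Ox).
by apply: IH (cf v) => x /nfg; exact: near_eq_derive.
Qed.

Lemma is_Ck_le k V W (O : set V) (f : V -> W) :
  is_Ck k.+1 O f -> is_Ck k O f.
Proof.
elim: k f => [|k IH] f [df cf].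
  by move=> x /df; exact: differentiable_continuous.
by split=> // v; exact: IH (cf v).
Qed.

Lemma is_Ck_cst k V W (O : set V) (a : W) :
  open O -> is_Ck k O (fun _ : V => a).
Proof.
move=> oO; elim: k a => [|k IH] a /=; first by move=> x _; exact: cvg_cst.
split=> [x _|v]; first exact: differentiable_cst.
by apply: is_Ck_ext (IH 0) => // x _; rewrite derive_cst.
Qed.

Lemma is_Ck_linear k V W (O : set V) (f : {linear V -> W}) :
  open O -> continuous f -> is_Ck k O f.
Proof.
move=> oO cf; case: k => [|k]; first by move=> x _; exact: cf.
split=> [x _|v]; first exact: linear_differentiable.
apply: is_Ck_ext (is_Ck_cst k (f v) oO) => // x _.
by rewrite deriveE; [rewrite diff_lin|exact: linear_differentiable].
Qed.

Lemma is_CkD k V W (O : set V) (f g : V -> W) : open O ->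
  is_Ck k O f -> is_Ck k O g -> is_Ck k O (fun x => f x + g x).
Proof.
move=> oO; elim: k f g => [|k IH] f g /=.
  by move=> cf cg x Ox; apply: cvgD; [exact: cf|exact: cg].
move=> [df cf] [dg cg]; split=> [x Ox|v].
  by apply: differentiableD; [exact: df|exact: dg].
apply: is_Ck_ext (IH _ _ (cf v) (cg v)) => // x Ox.
rewrite [RHS](_ : _ = 'D_v (f + g) x)// deriveD //; apply: diff_derivable.
  exact: df.
exact: dg.
Qed.

Lemma is_Ck_sum k V W (O : set V) I (r : seq I) (f : I -> V -> W) :
  open O -> (forall i, is_Ck k O (f i)) ->
  is_Ck k O (fun x => \sum_(i <- r) f i x).
Proof.
move=> oO cf; elim: r => [|i r IH].
  by under eq_fun do rewrite big_nil; exact: is_Ck_cst.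
by under eq_fun do rewrite big_cons; exact: is_CkD.
Qed.

Lemma is_CkM k V (O : set V) (f g : V -> R) : open O ->
  is_Ck k O f -> is_Ck k O g -> is_Ck k O (fun x => f x * g x).
Proof.
move=> oO; elim: k f g => [|k IH] f g.
  by move=> cf cg x Ox; apply: cvgM; [exact: cf|exact: cg].
move=> Cf Cg; have [df cf] := Cf; have [dg cg] := Cg; split=> [x Ox|v].
  by apply: differentiableM; [exact: df|exact: dg].
have cD := is_CkD oO (IH _ _ (is_Ck_le Cf) (cg v))
                     (IH _ _ (is_Ck_le Cg) (cf v)).
apply: is_Ck_ext cD => // x Ox.
rewrite [RHS](_ : _ = 'D_v (f * g) x)// deriveM //; apply: diff_derivable.
  exact: df.
exact: dg.
Qed.

Lemma differentiable_mxP V m n (f : V -> 'M[R]_(m, n)) x :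
  differentiable f x <-> forall i j, differentiable (fun y => f y i j) x.
Proof.
split=> [df i j|df].
  exact: (@differentiable_comp _ _ _ _ f (fun N : 'M[R]_(m, n) => N i j : R) x df
    (differentiable_coord _ _ _)).
pose ij (k : 'I_#|{: 'I_m * 'I_n}|) : 'I_m * 'I_n := enum_val k.
have -> : f = \sum_(k < #|{: 'I_m * 'I_n}|)
    (fun y => f y (ij k).1 (ij k).2 *: delta_mx (ij k).1 (ij k).2).
  apply/funext => y; rewrite fct_sumE [LHS]matrix_sum_delta pair_big/=.
  by rewrite (reindex ij)//; exact/onW_bij/enum_val_bij.
by apply: differentiable_sum => k; apply: differentiableZl.
Qed.

Lemma is_Ck_mxP k V m n (O : set V) (f : V -> 'M[R]_(m, n)) : open O ->
  is_Ck k O f <-> forall i j, is_Ck k O (fun y => f y i j).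
Proof.
move=> oO; elim: k f => [|k IH] f.
  split=> [cf i j x Ox|cf x Ox].
    exact: (continuous_comp (cf x Ox) (@coord_continuous _ _ _ i j _)).
  apply/cvgrPdist_le => e e0; near=> y.
  rewrite [leLHS]/Num.Def.normr/= mx_normrE (bigmax_le _ (ltW e0))//= => i _.
  rewrite !mxE/=; move: i; near: y; apply: filter_forall => /= i.
  by move/cvgrPdist_le: (cf i.1 i.2 x Ox); exact.
split=> [[df cf] i j|cf].
  split=> [x Ox|v]; first by move/differentiable_mxP: (df x Ox); exact.
  apply: is_Ck_ext ((IH _).1 (cf v) i j) => // x Ox.
  by rewrite derive_mx ?mxE//; exact/diff_derivable/df.
have df x : O x -> differentiable f x.
  by move=> Ox; apply/differentiable_mxP => i j; exact: (cf i j).1.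
split=> // v; apply/IH => i j; apply: is_Ck_ext ((cf i j).2 v) => // x Ox.
by rewrite derive_mx ?mxE//; exact/diff_derivable/df.
Unshelve. all: by end_near. Qed.

End Calculus.

Section Calculus2.
Context {R : realType}.
Implicit Types V W : normedModType R.

(** The chain rule in coordinates, which stays within derivatives of functions
    of the same kind and so lends itself to induction on the class C^k. *)
Lemma derive_comp V W n (u : V -> 'rV[R]_n) (f : 'rV[R]_n -> W) x v :
  differentiable u x -> differentiable f (u x) ->
  'D_v (f \o u) x = \sum_i 'D_v u x 0 i *: 'D_(delta_mx 0 i) f (u x).
Proof.
move=> du df; rewrite deriveE; last exact: differentiable_comp.
rewrite diff_comp//= -(deriveE v du) {1}['D_v u x]row_sum_delta linear_sum.
by apply: eq_bigr => i _; rewrite linearZZ -deriveE.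
Qed.

Lemma derive_line V W (f : V -> W) (v y : V) (s : R) :
  differentiable f (s *: v + y) ->
  is_derive s 1 (fun t : R => f (t *: v + y)) ('D_v f (s *: v + y)).
Proof.
move=> df; pose l t : V := t *: v + y.
have dl : is_diff s l ( *:%R ^~ v).
  have dz := is_diff_scalel s v.
  apply: is_diff_eq (is_diffD dz (is_diff_cst y s)) _.
  by apply/funext => t; rewrite !fctE addr0.
have dfl : differentiable (f \o l) s by exact: differentiable_comp.
apply: DeriveDef; first exact: diff_derivable.
have d1 : 'd (f \o l) s 1 = 'd f (l s) v.
  by rewrite diff_comp//= (@diff_val _ _ _ _ _ _ _ dl) scale1r.
by rewrite -[LHS]/('D_1 (f \o l) s) !deriveE.
Qed.

(** The mean value theorem, along v and then along w: a second difference is a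
    second derivative at a point that is as close to x as desired. *)
Lemma second_difference V (O : set V) (f : V -> R) x v w (E : set V) :
  open O -> is_Ck 2 O f -> O x -> nbhs x E ->
  \forall h \near 0^'+, exists2 z, E z &
    f (h *: v + (h *: w + x)) - f (h *: v + x) - f (h *: w + x) + f x
    = h ^+ 2 * 'D_w (fun y => 'D_v f y) z.
Proof.
move=> oO [df ddf] Ox Ex.
(* For small h, the parallelogram at x spanned by h v and h w lies in O and
   in E. *)
pose p (cd : R * R) := cd.1 *: v + (cd.2 *: w + x).
have cp : p cd @[cd --> ((0 : R), (0 : R))] --> p (0, 0).
  apply: (@cvgD _ _ _ (nbhs ((0 : R), (0 : R))) _
    (fun cd => cd.1 *: v) (fun cd => cd.2 *: w + x)).
    by apply: cvgZr_tmp; exact: cvg_fst.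
  apply: (@cvgD _ _ _ (nbhs ((0 : R), (0 : R))) _
    (fun cd => cd.2 *: w)); last exact: cvg_cst.
  by apply: cvgZr_tmp; exact: cvg_snd.
have p0 : p (0, 0) = x by rewrite /p !scale0r !add0r.
have : nbhs (p (0, 0)) (E `&` O).
  by rewrite p0; apply: filterI => //; exact: open_nbhs_nbhs.
move=> /cp [[A B] /= [/nbhs_ballP[a /= a0 aA] /nbhs_ballP[b /= b0 bB]] AB].
have EO c d h : 0 <= c <= h -> 0 <= d <= h -> h < Num.min a b ->
    (E `&` O) (c *: v + (d *: w + x)).
  move=> /andP[c0 ch] /andP[d0 dh]; rewrite lt_min => /andP[ha hb].
  apply: (AB (c, d)); split => /=.
    by apply: aA; rewrite /ball/= sub0r normrN ger0_norm// (le_lt_trans ch).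
  by apply: bB; rewrite /ball/= sub0r normrN ger0_norm// (le_lt_trans dh).
near=> h.
have h0 : 0 < h by near: h; exact: nbhs_right_gt.
have hab : h < Num.min a b.
  by near: h; apply: nbhs_right_lt; rewrite lt_min a0 b0.
have D1 s y : O (s *: v + y) ->
    is_derive s 1 (fun t : R => f (t *: v + y)) ('D_v f (s *: v + y)).
  by move=> Oy; apply: derive_line; exact: df.
have D2 s y : O (s *: w + y) ->
    is_derive s 1 (fun t : R => 'D_v f (t *: w + y))
                  ('D_w (fun y => 'D_v f y) (s *: w + y)).
  by move=> Oy; apply: (@derive_line _ _ (fun z => 'D_v f z)); exact: (ddf v).1.
(* First the difference along v of the increment of f by h w, then the
   increment by h w of the derivative along v. *)
pose g s := f (s *: v + (h *: w + x)) - f (s *: v + x).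
pose dg s := 'D_v f (s *: v + (h *: w + x)) - 'D_v f (s *: v + x).
have Oc c : 0 <= c <= h -> O (c *: v + x) /\ O (c *: v + (h *: w + x)).
  move=> ch; split; last by apply: (EO c h h _ _ hab).2; rewrite // (ltW h0) /=.
  have [] := EO c 0 h ch _ hab; first by rewrite lexx ltW.
  by rewrite scale0r add0r.
have Dg c : 0 <= c <= h -> is_derive c 1 g (dg c).
  by move=> /Oc[Oc1 Oc2]; apply: is_deriveB; exact: D1.
have [||c ch gE] := @MVT _ g dg 0 h h0.
- by move=> c; rewrite in_itv/= => /andP[c0 ch]; apply: Dg; rewrite !ltW.
- apply: derivable_within_continuous => c; rewrite in_itv/= => ch.
  by case: (Dg c ch).
have {}ch : 0 <= c <= h.
  by move: ch; rewrite in_itv/= => /andP[? ?]; rewrite !ltW.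
pose k s := 'D_v f (s *: w + (c *: v + x)).
pose dk s := 'D_w (fun y => 'D_v f y) (s *: w + (c *: v + x)).
have Od d : 0 <= d <= h -> (E `&` O) (d *: w + (c *: v + x)).
  by move=> dh; rewrite addrCA; exact: EO ch dh hab.
have Dk d : 0 <= d <= h -> is_derive d 1 k (dk d).
  by move=> /Od[_ ?]; exact: D2.
have [||d dh kE] := @MVT _ k dk 0 h h0.
- by move=> d; rewrite in_itv/= => /andP[d0 dh]; apply: Dk; rewrite !ltW.
- apply: derivable_within_continuous => d; rewrite in_itv/= => dh.
  by case: (Dk d dh).
have {}dh : 0 <= d <= h.
  by move: dh; rewrite in_itv/= => /andP[? ?]; rewrite !ltW.
exists (d *: w + (c *: v + x)); first by case: (Od d dh).
have dgE : dg c = k h - k 0.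
  by rewrite /dg /k scale0r add0r addrCA.
move: gE; rewrite dgE kE /g /dk !scale0r !add0r !subr0 => gE.
by rewrite expr2 [RHS]mulrC mulrA -gE; ring.
Unshelve. all: by end_near. Qed.

Lemma distr_le_half (a b c e : R) :
  `|a - c| < e / 2 -> `|b - c| < e / 2 -> `|a - b| <= e.
Proof. by rewrite !ltr_norml ler_norml => /andP[? ?] /andP[? ?]; lra. Qed.

(** Symmetry of second derivatives: the second difference of f along v and w
    does not change when v and w are exchanged, so that both iterated
    derivatives take a common value at points close to x. *)
Lemma derive_comm V (O : set V) (f : V -> R) x v w :
  open O -> is_Ck 2 O f -> O x ->
  'D_w (fun y => 'D_v f y) x = 'D_v (fun y => 'D_w f y) x.
Proof.
move=> oO cf Ox; apply/eqP; rewrite -subr_eq0 -normr_le0.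
apply/ler_addgt0Pl => e e0; rewrite addr0.
have nE v' w' : \forall z \near x, `|'D_w' (fun y => 'D_v' f y) x -
   'D_w' (fun y => 'D_v' f y) z| < e / 2.
  have cD : {for x, continuous (fun z => 'D_w' (fun y => 'D_v' f y) z)}.
    exact: ((cf.2 v').2 w').
  by move/cvgrPdist_lt: cD; apply; rewrite divr_gt0.
have n1 := second_difference v w oO cf Ox (nE v w).
have n2 := second_difference w v oO cf Ox (nE w v).
have [h [h0 [[z Ez zE] [z' Ez' zE']]]] :=
  filter_ex (filterI (nbhs_right_gt (0 : R)) (filterI n1 n2)).
have zz' : 'D_w (fun y => 'D_v f y) z = 'D_v (fun y => 'D_w f y) z'.
  apply: (@mulfI _ (h ^+ 2)); first by rewrite expf_neq0// gt_eqF.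
  rewrite addrCA in zE'; apply: etrans (esym zE) _; apply: etrans zE'.
  by congr (_ + _); exact: addrAC.
by apply: distr_le_half Ez _; rewrite zz'; exact: Ez'.
Qed.

Lemma is_Ck_comp k V n (O : set V) (O' : set 'rV[R]_n) (u : V -> 'rV[R]_n)
    (f : 'rV[R]_n -> R) : open O -> open O' ->
  (forall x, O x -> O' (u x)) ->
  is_Ck k O u -> is_Ck k O' f -> is_Ck k O (fun x => f (u x)).
Proof.
move=> oO oO' OO'; elim: k u f OO' => [|k IH] u f OO'.
  move=> cu cf x Ox; apply: continuous_comp; first exact: cu.
  exact/cf/OO'.
move=> Cu [df cf]; have [du cu] := Cu; split=> [x Ox|v].
  by apply: (differentiable_comp (du x Ox)); exact/df/OO'.
have cs : is_Ck k O (fun x =>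
    \sum_i 'D_v u x 0 i * 'D_(delta_mx 0 i) f (u x)).
  apply: is_Ck_sum => // i; apply: is_CkM => //.
    exact: ((is_Ck_mxP _ _ oO).1 (cu v) 0 i).
  exact: (IH _ (fun y => 'D_(delta_mx 0 i) f y) OO' (is_Ck_le Cu) (cf _)).
refine (@is_Ck_ext _ _ _ _ _ _ _ oO _ cs); move=> x Ox.
exact: esym (derive_comp v (du x Ox) (df _ (OO' _ Ox))).
Qed.

Lemma is_Ck_comp_mx k V n p q (O : set V) (O' : set 'rV[R]_n)
    (u : V -> 'rV[R]_n) (f : 'rV[R]_n -> 'M[R]_(p, q)) : open O -> open O' ->
  (forall x, O x -> O' (u x)) ->
  is_Ck k O u -> is_Ck k O' f -> is_Ck k O (fun x => f (u x)).
Proof.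
move=> oO oO' OO' cu /(is_Ck_mxP _ _ oO') cf.
by apply/(is_Ck_mxP _ _ oO) => i j; exact: is_Ck_comp (cf i j).
Qed.

Lemma is_Ck_mulmx k V m n p (O : set V) (A : V -> 'M[R]_(m, n))
    (B : V -> 'M[R]_(n, p)) : open O ->
  is_Ck k O A -> is_Ck k O B -> is_Ck k O (fun x => A x *m B x).
Proof.
move=> oO /(is_Ck_mxP _ _ oO) cA /(is_Ck_mxP _ _ oO) cB.
apply/(is_Ck_mxP _ _ oO) => i j; under eq_fun do rewrite mxE.
by apply: is_Ck_sum => // l; exact: is_CkM.
Qed.

Lemma jacobianE m n (u : 'rV[R]_m -> 'rV[R]_n) x i j :
  differentiable u x -> jacobian u x i j = 'D_(delta_mx 0 i) u x 0 j.
Proof. by move=> du; rewrite deriveEjacobian// -rowE [RHS]mxE. Qed.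

Lemma is_Ck_jacobian k m n (O : set 'rV[R]_m) (u : 'rV[R]_m -> 'rV[R]_n) :
  open O -> is_Ck k.+1 O u -> is_Ck k O (jacobian u).
Proof.
move=> oO [du cu]; apply/(is_Ck_mxP _ _ oO) => i j.
have := (is_Ck_mxP _ _ oO).1 (cu (delta_mx 0 i)) 0 j.
by apply: is_Ck_ext => // x /du /jacobianE ->.
Qed.

Lemma jacobian_comp m n p (u : 'rV[R]_m -> 'rV[R]_n)
    (f : 'rV[R]_n -> 'rV[R]_p) x :
  differentiable u x -> differentiable f (u x) ->
  jacobian (f \o u) x = jacobian u x *m jacobian f (u x).
Proof.
move=> du df; have dfu := differentiable_comp du df.
apply/row_matrixP => i; rewrite row_mul !rowE.
rewrite -(deriveEjacobian _ dfu) -(deriveEjacobian _ du).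
by rewrite -(deriveEjacobian _ df) (deriveE _ dfu) (diff_comp du df) !deriveE.
Qed.

End Calculus2.

(** * Smooth maps on regular subsets *)

Section Within.
Context {R : realType}.
Implicit Types V W : normedModType R.

(** Charts of manifolds with boundary and standard simplices satisfy this
    condition.  It makes derivatives at boundary points independent of the
    smooth extension by which they are defined. *)
Definition regular_dom V (D : set V) := D `<=` closure (interior D).

Lemma open_setI_preimage V W (O : set V) (O' : set W) (u : V -> W) :
  open O -> open O' -> (forall x, O x -> {for x, continuous u}) ->
  open (O `&` u @^-1` O').
Proof.
move=> oO oO' cu; rewrite openE => x [Ox O'x]; apply: filterI.
  exact: open_nbhs_nbhs.
by apply: (cu x Ox); exact: open_nbhs_nbhs.
Qed.

Lemma is_Cinfty_continuous V W (O : set V) (u : V -> W) x :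
  is_Cinfty O u -> O x -> {for x, continuous u}.
Proof. by move=> cu; exact: (cu 0%N). Qed.

Lemma is_Cinfty_differentiable V W (O : set V) (u : V -> W) x :
  is_Cinfty O u -> O x -> differentiable u x.
Proof. by move=> cu; exact: (cu 1%N).1. Qed.

Lemma is_Cinfty_derive V W (O : set V) (u : V -> W) v :
  is_Cinfty O u -> is_Cinfty O (fun x => 'D_v u x).
Proof. by move=> cu k; exact: (cu k.+1).2. Qed.

Lemma is_Cinfty_sub V W (O O' : set V) (f : V -> W) :
  O' `<=` O -> is_Cinfty O f -> is_Cinfty O' f.
Proof. by move=> sO cf k; exact: is_Ck_sub (cf k). Qed.

(** At the interior points of D near x both derivatives agree, and x is a limit
    of such points; the derivatives are continuous at x. *)
Lemma derive_unique V W (D O : set V) (g1 g2 : V -> W) x v :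
  regular_dom D -> D x -> open O -> O x -> is_Cinfty O g1 -> is_Cinfty O g2 ->
  (forall y, O y -> D y -> g1 y = g2 y) -> 'D_v g1 x = 'D_v g2 x.
Proof.
move=> rD Dx oO Ox /(is_Cinfty_derive v) c1 /(is_Cinfty_derive v) c2 g12.
apply/eqP; rewrite -subr_eq0 -normr_eq0; apply/negPn/negP => e0.
pose e y := 'D_v g1 y - 'D_v g2 y.
have ce : e y @[y --> x] --> e x.
  by apply: cvgB; [exact: is_Cinfty_continuous c1 Ox
                  |exact: is_Cinfty_continuous c2 Ox].
have egt0 : 0 < `|e x| by rewrite lt_neqAle eq_sym e0 normr_ge0.
have ne : \forall y \near x, `|e x - e y| < `|e x|.
  by move/cvgrPdist_lt: ce; exact.
have [y [Dy [/= Oy]]] := rD _ Dx _ (filterI (open_nbhs_nbhs (conj oO Ox)) ne).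
rewrite {2}/e (near_eq_derive v (f:=g1) (g:=g2)) ?subrr ?subr0 ?ltxx//.
near=> z; apply: g12; first by near: z; exact: open_nbhs_nbhs.
by near: z.
Unshelve. all: by end_near. Qed.

Lemma derive_withinE V W (A : set V) (f : V -> W) x v g :
  regular_dom A -> A x -> smooth_extension A f x g ->
  derive_within A f x v = 'D_v g x.
Proof.
move=> rA Ax [ O [oO Ox cg gf]]; rewrite /derive_within.
have : [set y | exists2 g, smooth_extension A f x g & y = 'D_v g x]
         ('D_v g x) by exists g => //; exists O.
move=> /getI => -[g' [ O' [oO' O'x cg' gf']] ->].
apply: (derive_unique (D := A) (O := O `&` O')) => //; first exact: openI.
- exact: is_Cinfty_sub cg'.
- exact: is_Cinfty_sub cg.
- by move=> y [Oy O'y] Ay; rewrite gf// gf'.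
Qed.

Lemma smooth_extension_derive V W (A : set V) (f : V -> W) x v g :
  regular_dom A -> smooth_extension A f x g ->
  smooth_extension A (fun y => derive_within A f y v) x (fun y => 'D_v g y).
Proof.
move=> rA [ O [oO Ox cg gf]]; exists O; split => //.
  exact: is_Cinfty_derive.
by move=> y Oy Ay; apply/esym/derive_withinE => //; exists O.
Qed.

Lemma smooth_within_derive V W (A : set V) (f : V -> W) v :
  regular_dom A -> smooth_within A f ->
  smooth_within A (fun y => derive_within A f y v).
Proof.
by move=> rA sf x /sf[g fg]; exists (fun y => 'D_v g y);
  exact: smooth_extension_derive.
Qed.

Lemma smooth_extension_entry V m n (A : set V) (f : V -> 'M[R]_(m, n)) x g i j :
  smooth_extension A f x g ->
  smooth_extension A (fun y => f y i j) x (fun y => g y i j).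
Proof.
move=> [ O [oO Ox cg gf]]; exists O; split => //.
  by move=> k; exact: (is_Ck_mxP _ _ oO).1 (cg k) i j.
by move=> y Oy Ay; rewrite gf.
Qed.

Lemma smooth_within_continuous V W (A : set V) (f : V -> W) :
  smooth_within A f -> {within A, continuous f}.
Proof.
move=> sf; apply/subspace_continuousP => x Ax.
have [g [ O [oO Ox cg gf]]] := sf x Ax.
have : g @ within A (nbhs x) --> f x.
  rewrite -gf//; apply: cvg_trans (is_Cinfty_continuous cg Ox).
  by apply: cvg_app; exact: cvg_within.
apply: cvg_trans; apply: near_eq_cvg; rewrite near_withinE.
by apply: filterS (open_nbhs_nbhs (conj oO Ox)) => y Oy; exact: gf.
Qed.

(** The algebra of the formula for d of a pull-back: the terms a j, which stand
    for second derivatives of the map, cancel. *)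
Lemma sum_antisymmetrization n (a p q : 'I_n -> R) (T : 'I_n -> 'I_n -> R) :
  \sum_j (a j + q j * \sum_i p i * T i j)
    - \sum_j (a j + p j * \sum_i q i * T i j)
  = \sum_j \sum_i p i * q j * (T i j - T j i).
Proof.
have -> : \sum_j \sum_i p i * q j * (T i j - T j i) =
    \sum_j \sum_i q j * (p i * T i j) - \sum_j \sum_i p j * (q i * T i j).
  rewrite [X in _ = _ - X]exchange_big -sumrB; apply: eq_bigr => j _.
  by rewrite -sumrB; apply: eq_bigr => i _; ring.
rewrite !big_split/= opprD addrACA subrr add0r.
by congr (_ - _); apply: eq_bigr => j _; rewrite mulr_sumr.
Qed.

(** The matrix of the exterior derivative of the one-form with coefficients a;
    thus ext_d1 of a one-form is the curl of its coefficients in each chart. *)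
Definition curl n (D : set 'rV[R]_n) (a : 'rV[R]_n -> 'cV[R]_n) x : 'M[R]_n :=
  \matrix_(k, l) (derive_within D (fun y => a y l 0) x (delta_mx 0 k)
                - derive_within D (fun y => a y k 0) x (delta_mx 0 l)).

Lemma curl_entry_continuous n (D : set 'rV[R]_n) b k l :
  regular_dom D -> smooth_within D b ->
  {within D, continuous (fun z => curl D b z k l)}.
Proof.
move=> rD sb.
have sbl i : smooth_within D (fun z => b z i 0).
  move=> z /sb[g gb]; exists (fun z => g z i 0).
  exact: smooth_extension_entry.
have c1 := smooth_within_continuous
  (smooth_within_derive (delta_mx 0 k) rD (sbl l)).
have c2 := smooth_within_continuous
  (smooth_within_derive (delta_mx 0 l) rD (sbl k)).
have c12 := within_continuousB c1 c2.
apply: subspace_eq_continuous c12 => z _.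
by rewrite /from_subspace/= /curl mxE.
Qed.

Section CurlPullback.
Context {k n : nat} {D O : set 'rV[R]_k} {E : set 'rV[R]_n}.
Context {u : 'rV[R]_k -> 'rV[R]_n} {a : 'rV[R]_n -> 'cV[R]_n}.
Context {b : 'rV[R]_k -> 'cV[R]_k}.
Hypotheses (rD : regular_dom D) (rE : regular_dom E) (oO : open O).
Hypotheses (cu : is_Cinfty O u) (uE : forall y, O y -> D y -> E (u y)).
Hypotheses (sa : smooth_within E a).
Hypotheses (bE : forall y, O y -> D y -> b y = jacobian u y *m a (u y)).

Lemma smooth_extension_pullback x : O x -> D x ->
  exists2 g, smooth_extension E a (u x) g &
    smooth_extension D b x (fun y => jacobian u y *m g (u y)).
Proof.
move=> Ox Dx; have [g [ O' [oO' O'x cg ga]]] := sa (uE Ox Dx).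
exists g; first by exists O'.
have oO2 : open (O `&` u @^-1` O').
  by apply: open_setI_preimage => // y; exact: is_Cinfty_continuous.
exists (O `&` u @^-1` O'); split => //.
  move=> r; apply: is_Ck_mulmx => //.
    by apply: is_Ck_jacobian => //; apply: is_Ck_sub (cu r.+1) => y [].
  apply: (is_Ck_comp_mx (O' := O')) => //; first by move=> y [].
  by apply: is_Ck_sub (cu r) => y [].
by move=> y [Oy O'y] Dy; rewrite bE// ga//; exact: uE.
Qed.

(** The exterior derivative commutes with pull-back.  In the derivative of the
    pulled back coefficients, the second derivatives of u are symmetric and
    disappear by antisymmetrization. *)
Lemma curl_pullback x : O x -> D x ->
  curl D b x = jacobian u x *m curl E a (u x) *m (jacobian u x)^T.
Proof.
move=> Ox Dx; have [g ga gb] := smooth_extension_pullback Ox Dx.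
have Eux := uE Ox Dx.
have uk r j : is_Cinfty O (fun y => 'D_(delta_mx 0 r) u y 0 j).
  move=> q; exact: ((is_Ck_mxP _ _ oO).1 (is_Cinfty_derive _ cu q)).
have dg j : differentiable (fun z => g z j 0) (u x).
  have [ O' [oO' O'x cg _]] := smooth_extension_entry j 0 ga.
  exact: is_Cinfty_differentiable cg O'x.
have Dagj j i : derive_within E (fun y => a y j 0) (u x) (delta_mx 0 i) =
    'D_(delta_mx 0 i) (fun y => g y j 0) (u x).
  by apply: derive_withinE => //; exact: smooth_extension_entry.
have Db l r : derive_within D (fun y => b y l 0) x (delta_mx 0 r) =
    \sum_j ('D_(delta_mx 0 r) (fun y => 'D_(delta_mx 0 l) u y 0 j) x
              * g (u x) j 0
          + 'D_(delta_mx 0 l) u x 0 j *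
            \sum_i 'D_(delta_mx 0 r) u x 0 i *
                     'D_(delta_mx 0 i) (fun y => g y j 0) (u x)).
  have := smooth_extension_entry l 0 gb.
  move=> /(derive_withinE _ rD Dx) ->.
  have nx : \forall y \near x, (jacobian u y *m g (u y)) l 0 =
      (\sum_j (fun y => 'D_(delta_mx 0 l) u y 0 j * g (u y) j 0)) y.
    near=> y; rewrite mxE fct_sumE; apply: eq_bigr => j _.
    rewrite jacobianE//; apply: is_Cinfty_differentiable cu _.
    by near: y; exact: open_nbhs_nbhs.
  rewrite (near_eq_derive _ nx).
  have du := is_Cinfty_differentiable cu Ox.
  have dgu j : differentiable (fun y => g (u y) j 0) x.
    by apply: (differentiable_comp (g := fun z => g z j 0) du); exact: dg.
  have dul j : differentiable (fun y => 'D_(delta_mx 0 l) u y 0 j) x.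
    exact: is_Cinfty_differentiable (uk l j) Ox.
  rewrite derive_sum; last first.
    by move=> j; apply: diff_derivable; exact: differentiableM.
  apply: eq_bigr => j _.
  rewrite [LHS](deriveM (diff_derivable _) (diff_derivable _))//.
  rewrite addrC; congr (_ + _); first by rewrite [LHS]mulrC.
  by congr (_ * _); exact: (derive_comp _ du (dg j)).
have symu l r j : 'D_(delta_mx 0 r) (fun y => 'D_(delta_mx 0 l) u y 0 j) x =
    'D_(delta_mx 0 l) (fun y => 'D_(delta_mx 0 r) u y 0 j) x.
  have cuj : is_Ck 2 O (fun y => u y 0 j).
    exact: (is_Ck_mxP _ _ oO).1 (cu 2) 0 j.
  have E1 q v' : 'D_v' (fun y => 'D_(delta_mx 0 q) u y 0 j) x =
      'D_v' (fun y => 'D_(delta_mx 0 q) (fun z => u z 0 j) y) x.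
    apply: near_eq_derive; near=> y.
    have du : differentiable u y.
      by apply: is_Cinfty_differentiable cu _; near: y; exact: open_nbhs_nbhs.
    by rewrite derive_mx ?mxE//; exact: diff_derivable.
  have E2 := derive_comm (delta_mx 0 l) (delta_mx 0 r) oO cuj Ox.
  by rewrite [LHS](E1 l (delta_mx 0 r)) [RHS](E1 r (delta_mx 0 l)); exact: E2.
apply/matrixP => r l; rewrite [LHS]mxE !Db.
under [X in X - _]eq_bigr do rewrite symu.
rewrite sum_antisymmetrization [in RHS]mxE; apply: eq_bigr => j _.
rewrite [in RHS]mxE big_distrl/=; apply: eq_bigr => i _.
have du := is_Cinfty_differentiable cu Ox.
by rewrite [curl _ _ _ _ _]mxE [trmx _ _ _]mxE !Dagj !jacobianE// mulrAC.
Unshelve. all: by end_near. Qed.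

End CurlPullback.
End Within.

(** * Charts of manifolds with boundary and pull-back of one-forms *)

(* Unification problems between the derivatives of two maps, or at two points,
   are never solved by unfolding the limits in their definition. *)
Opaque jacobian derive diff.

Section RegularDomains.
Context {R : realType}.

Lemma regular_open (V : normedModType R) (O : set V) : open O -> regular_dom O.
Proof.
by move=> oO x Ox; apply: subset_closure; exact: open_nbhs_nbhs.
Qed.

(** It is enough to be able to leave each point towards the interior along a
    segment. *)
Lemma regular_domP (V : normedModType R) (D : set V) :
  (forall x, D x -> exists v,
     \forall e \near 0^'+, (interior D) (x + e *: v)) -> regular_dom D.
Proof.
move=> Dv x Dx B nB; have [v ev] := Dv x Dx.
have cv : x + e *: v @[e --> (0 : R)^'+] --> x.
  rewrite -[X in _ --> X]addr0 -(scale0r v).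
  apply: cvgD; first exact: cvg_cst.
  by apply: cvgZr_tmp; exact: cvg_at_right_filter.
have [e [? ?]] := filter_ex (filterI ev (cv B nB)).
by exists (x + e *: v).
Qed.

(** The vector (1, ..., 1) points inwards, also in dimension 0, where no
    coordinate is constrained. *)
Lemma regular_half_space n (O : set 'rV[R]_n) : open O ->
  regular_dom (O `&` @half_space R n).
Proof.
move=> oO; apply: regular_domP => x [ Ox Hx]; exists (const_mx 1).
have cv : x + e *: (const_mx 1 : 'rV[R]_n) @[e --> (0 : R)^'+] --> x.
  rewrite -[X in _ --> X]addr0 -(scale0r (const_mx 1 : 'rV[R]_n)).
  apply: cvgD; first exact: cvg_cst.
  by apply: cvgZr_tmp; exact: cvg_at_right_filter.
near=> e.
have e0 : 0 < e by near: e; exact: nbhs_right_gt.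
have Oe : O (x + e *: const_mx 1).
  by near: e; apply: cv; exact: open_nbhs_nbhs.
pose y := x + e *: const_mx 1.
have nO : nbhs y O by exact: open_nbhs_nbhs.
suff nH : nbhs y (@half_space R n) by exact: filterI nO nH.
suff nH : nbhs y (fun z : 'rV[R]_n =>
  forall i : 'I_n, i = 0%N :> nat -> 0 <= z 0 i) by [].
apply: (@filter_forall _ _ (fun (i : 'I_n) (z : 'rV[R]_n) =>
  i = 0%N :> nat -> 0 <= z 0 i) (nbhs y)) => i.
have [i0|/eqP i0] := eqVneq (i : nat) 0%N; last by apply: nearW.
near=> z => _.
have : 0 < z 0 i; last exact: ltW.
near: z; have cyi := @coord_continuous R 1 n 0 i y.
by apply: (cvgr_gt _ cyi); rewrite !mxE mulr1 ltr_wpDl//; exact: Hx i0.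
Unshelve. all: by end_near. Qed.

(** Moving towards the barycentre c makes all barycentric coordinates
    positive. *)
Lemma regular_simplex k : regular_dom (@std_simplex R k).
Proof.
apply: regular_domP => x [x0 x1].
pose c : 'rV[R]_k := const_mx k.+1%:R^-1.
have c0 : 0 < (k.+1%:R^-1 : R) by rewrite invr_gt0.
have c1 : \sum_i c 0 i < 1.
  under eq_bigr do rewrite mxE.
  rewrite sumr_const card_ord -[X in X < _]mulr_natl ltr_pdivrMr// mul1r.
  by rewrite ltr_nat.
exists (c - x); near=> e.
have e0 : 0 < e by near: e; exact: nbhs_right_gt.
have e1 : e < 1 by near: e; exact: nbhs_right_lt.
pose y := x + e *: (c - x).
have y0 i : 0 < y 0 i.
  rewrite !mxE; have := x0 i => xi0.
  have -> : x 0 i + e * (k.+1%:R^-1 - x 0 i) = (1 - e) * x 0 i + e * k.+1%:R^-1.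
    by ring.
  by rewrite ltr_wpDl ?mulr_gt0 ?mulr_ge0// subr_ge0 ltW.
have y1 : \sum_i y 0 i < 1.
  have -> : \sum_i y 0 i = (1 - e) * (\sum_i x 0 i) + e * (\sum_i c 0 i).
    rewrite !mulr_sumr -big_split; apply: eq_bigr => i _.
    by rewrite !mxE /=; ring.
  rewrite -[ltRHS](subrK e 1) ler_ltD//.
    by rewrite ler_piMr// subr_ge0 ltW.
  by rewrite -[ltRHS]mulr1 ltr_pM2l.
have n0 : nbhs y [set z : 'rV[R]_k | forall i, 0 <= z 0 i].
  suff nz : nbhs y (fun z : 'rV[R]_k => forall i : 'I_k, 0 <= z 0 i) by [].
  apply: (@filter_forall _ _ (fun (i : 'I_k) (z : 'rV[R]_k) => 0 <= z 0 i)
    (nbhs y)) => i.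
  near=> z.
  have : 0 < z 0 i; last exact: ltW.
  near: z; have cyi := @coord_continuous R 1 k 0 i y.
  exact: (cvgr_gt _ cyi).
suff n1 : nbhs y [set z : 'rV[R]_k | \sum_i z 0 i <= 1] by exact: filterI n0 n1.
near=> z.
have : \sum_i z 0 i < 1; last exact: ltW.
near: z.
have cs : (\sum_i z 0 i) @[z --> y] --> \sum_i y 0 i.
  exact: (@is_Ck_sum R 0 'rV[R]_k R setT _ (index_enum 'I_k) (fun i z => z 0 i)
    openT (fun i x _ => @coord_continuous R 1 k 0 i x) y I).
exact: (cvgr_lt _ cs).
Unshelve. all: by end_near. Qed.

End RegularDomains.

Section Pullback.
Context {R : realType}.

Lemma jacobian_unique m n (D O : set 'rV[R]_m) (u u' : 'rV[R]_m -> 'rV[R]_n) x :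
  regular_dom D -> D x -> open O -> O x -> is_Cinfty O u -> is_Cinfty O u' ->
  (forall y, O y -> D y -> u y = u' y) -> jacobian u x = jacobian u' x.
Proof.
move=> rD Dx oO Ox cu cu' uu'.
apply/row_matrixP => i.
rewrite [LHS]rowE [RHS]rowE.
have du := is_Cinfty_differentiable cu Ox.
have du' := is_Cinfty_differentiable cu' Ox.
have uE := derive_unique (delta_mx 0 i) rD Dx oO Ox cu cu' uu'.
exact: etrans (esym (deriveEjacobian (delta_mx 0 i) du))
  (etrans uE (deriveEjacobian (delta_mx 0 i) du')).
Qed.

(** The part of the manifold axioms on which the pull-back of forms depends.
    It mentions no topology on M, and passes to the product with the line. *)
Definition compatible_charts n M (A : atlas R n M) : Prop :=
  [/\ (forall i : pidx A, regular_dom (pdom i)),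
      (forall (i : pidx A) x y,
         pdom i x -> pdom i y -> par i x = par i y -> x = y) &
      (forall (i j : pidx A) x y, pdom i x -> pdom j y -> par i x = par j y ->
         exists u, local_expr (par_on i) x j u)].

Lemma manifold_compatible n (M : topologicalType) (A : atlas R n M) :
  manifold_with_boundary A -> compatible_charts A.
Proof.
move=> [_ dA _ pA tA]; split => // [i|i].
  have [ O oO [->|->]] := dA i; first exact: regular_open.
  exact: regular_half_space.
by have [] := pA i.
Qed.

Definition in_dom T (D : set T) x (Dx : D x) : D := exist _ x (mem_set Dx).

Section LocalExpr.
Context {n : nat} {M : Type} {A : atlas R n M}.
Context {k : nat} {D : set 'rV[R]_k}.

Lemma local_expr_dom (f : D -> M) x j (u : 'rV[R]_k -> 'rV[R]_n) :
  local_expr f x j u -> D x -> pdom (a := A) j (u x).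
Proof. by move=> [ O [_ Ox _ fu]] Dx; case: (fu (in_dom Dx) Ox). Qed.

Lemma local_expr_comp k' (D' : set 'rV[R]_k') (f : D -> M) (f' : D' -> M)
    (al : 'rV[R]_k' -> 'rV[R]_k) (O' : set 'rV[R]_k') x' (j : pidx A) u :
  open O' -> O' x' -> is_Cinfty O' al ->
  (forall y', O' y' -> D' y' -> D (al y')) ->
  (forall (y' : D') (y : D), \val y = al (\val y') -> f' y' = f y) ->
  local_expr f (al x') j u -> local_expr f' x' j (u \o al).
Proof.
move=> oO' O'x' ca D'D ff' [ O [oO Ox cu fu]].
have oO2 : open (O' `&` al @^-1` O).
  by apply: open_setI_preimage => // y; exact: is_Cinfty_continuous.
exists (O' `&` al @^-1` O); split => //.
  move=> r; apply: (is_Ck_comp_mx (O' := O)) => //; first by move=> y [].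
  by apply: is_Ck_sub (ca r) => y [].
move=> y' [ O'y' /= Oay'].
have Dy : D (al (\val y')) by apply: D'D => //; exact: set_valP.
by have := fu (in_dom Dy) Oay'; rewrite -(ff' y' (in_dom Dy) erefl).
Qed.

Lemma local_expr_map p N (B : atlas R p N) (g : M -> N) (f : D -> M) x
    (j : pidx A) u (l : pidx B) v :
  D x -> local_expr f x j u -> local_expr (g \o par_on j) (u x) l v ->
  local_expr (g \o f) x l (v \o u).
Proof.
move=> Dx [ O [oO Ox cu fu]] [ O' [oO' O'x cv gv]].
have oO2 : open (O `&` u @^-1` O').
  by apply: open_setI_preimage => // y; exact: is_Cinfty_continuous.
exists (O `&` u @^-1` O'); split => //.
  move=> r; apply: (is_Ck_comp_mx (O' := O')) => //; first by move=> y [].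
  by apply: is_Ck_sub (cu r) => y [].
move=> y [ Oy /= O'uy]; have [Euy pE] := fu y Oy.
have [? gE] := gv (in_dom Euy) O'uy; split => //.
by rewrite gE /= /par_on /= pE.
Qed.

Context (a : pre_form1 A) (f : D -> M).

(** The same convention as for pullback2: the value given by some local
    expression. *)
Definition pullback1 (x : 'rV[R]_k) : 'cV[R]_k :=
  get [set b | exists (j : pidx A) u,
         local_expr f x j u /\ b = jacobian u x *m a j (u x)].

Hypotheses (cA : compatible_charts A) (fa : is_form1 a) (rD : regular_dom D).

(** Two local expressions of f at x differ by a transition map of the charts,
    at least on D; D being regular, this determines their differentials at x,
    and the transformation law of forms applies. *)
Lemma form1_change x (j j' : pidx A) u u' : D x ->
  local_expr f x j u -> local_expr f x j' u' ->
  jacobian u x *m a j (u x) = jacobian u' x *m a j' (u' x).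
Proof.
move=> Dx lu lu'; have [_ injA tA] := cA.
have Eu := local_expr_dom lu Dx; have Eu' := local_expr_dom lu' Dx.
have [ O [oO Ox cu fu]] := lu; have [ O' [oO' O'x cu' fu']] := lu'.
(* The transition phi from the chart j to the chart j' satisfies
   u' = phi o u on D near x. *)
have [phi lphi] : exists phi, local_expr (par_on j) (u x) j' phi.
  apply: (tA _ _ _ (u' x)) => //.
  by rewrite (fu (in_dom Dx) Ox).2 (fu' (in_dom Dx) O'x).2.
rewrite (fa.2 _ _ _ _ Eu lphi).
have [ O2 [oO2 O2x cphi fphi]] := lphi.
have uphi y : (O `&` O' `&` u @^-1` O2) y -> D y -> phi (u y) = u' y.
  move=> [[ Oy O'y] /= O2y] Dy.
  have [Ey pE] := fu (in_dom Dy) Oy; have [Ey' pE'] := fu' (in_dom Dy) O'y.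
  have [Ep pp] := fphi (in_dom Ey) O2y.
  by apply: injA Ep Ey' _; rewrite pp pE' /par_on /= pE.
have oO3 : open (O `&` O' `&` u @^-1` O2).
  apply: open_setI_preimage => //; first exact: openI.
  by move=> y [ Oy _]; exact: is_Cinfty_continuous cu Oy.
have du := is_Cinfty_differentiable cu Ox.
have dphi := is_Cinfty_differentiable cphi O2x.
have cphiu : is_Cinfty (O `&` O' `&` u @^-1` O2) (phi \o u).
  move=> r; apply: (is_Ck_comp_mx (O' := O2)) => //; first by move=> y [].
  by apply: is_Ck_sub (cu r) => y [[]].
have cu'3 : is_Cinfty (O `&` O' `&` u @^-1` O2) u'.
  by apply: is_Cinfty_sub cu' => y [[]].
have O3x : (O `&` O' `&` u @^-1` O2) x by [].
have JE : jacobian u x *m jacobian phi (u x) = jacobian u' x.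
  have J1 := jacobian_comp du dphi.
  have J2 := jacobian_unique rD Dx oO3 O3x cphiu cu'3 uphi.
  by rewrite J1 in J2.
apply: etrans (mulmxA _ _ _) _.
have -> : u' x = phi (u x) by rewrite -uphi.
exact: (congr1 (mulmx ^~ (a j' (phi (u x)))) JE).
Qed.

Lemma pullback1E x (j : pidx A) u : D x -> local_expr f x j u ->
  pullback1 x = jacobian u x *m a j (u x).
Proof.
move=> Dx lu; rewrite /pullback1.
have : [set b | exists (j : pidx A) u, local_expr f x j u /\
    b = jacobian u x *m a j (u x)] (jacobian u x *m a j (u x)).
  by exists j, u.
by move=> /getI[j' [u' [lu' ->]]]; exact: form1_change lu' lu.
Qed.

Lemma pullback1_near x (j : pidx A) u : local_expr f x j u ->
  exists O, [/\ open O, O x, is_Cinfty O u,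
    (forall y, O y -> D y -> pdom j (u y)) &
    (forall y, O y -> D y -> pullback1 y = jacobian u y *m a j (u y))].
Proof.
move=> [ O [oO Ox cu fu]].
have lu y : O y -> local_expr f y j u by move=> Oy; exists O.
exists O; split => // y Oy Dy; first exact: local_expr_dom (lu y Oy) Dy.
exact: pullback1E Dy (lu y Oy).
Qed.

Lemma curl_pullback1 x (j : pidx A) u : D x -> local_expr f x j u ->
  curl D pullback1 x
  = jacobian u x *m ext_d1 a j (u x) *m (jacobian u x)^T.
Proof.
move=> Dx /pullback1_near[ O [oO Ox cu uE pE]].
have [rA _ _] := cA.
exact: (curl_pullback rD (rA j) oO cu uE (fa.1 j) pE Ox Dx).
Qed.

Lemma smooth_pullback1 : smooth_into A f -> smooth_within D pullback1.
Proof.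
move=> sf x Dx; have [j [u /pullback1_near[ O [oO Ox cu uE pE]]]] := sf x Dx.
have [g _ gE] := smooth_extension_pullback oO cu uE (fa.1 j) pE Ox Dx.
by exists (fun y => jacobian u y *m g (u y)).
Qed.

(** The right-hand side involves no local expression, so that the value of
    pullback2 is the same for all of them. *)
Lemma pullback2_ext_d1 x : smooth_into A f -> D x ->
  pullback2 f (ext_d1 a) x = curl D pullback1 x.
Proof.
move=> sf Dx; have [j [u lu]] := sf x Dx; rewrite /pullback2.
have : [set B | exists (j : pidx A) u, local_expr f x j u /\
    B = jacobian u x *m ext_d1 a j (u x) *m (jacobian u x)^T]
    (curl D pullback1 x).
  by exists j, u; rewrite -curl_pullback1.
by move=> /getI[j' [u' [lu' ->]]]; rewrite -curl_pullback1.
Qed.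

End LocalExpr.
End Pullback.

(** * Green's formula on the triangle *)

Lemma within_continuous_compr (T U V : topologicalType) (A : set U)
    (B : set T) (f : U -> V) (g : T -> U) :
  continuous g -> (forall y, B y -> A (g y)) ->
  {within A, continuous f} -> {within B, continuous (f \o g)}.
Proof.
move=> cg BA /subspace_continuousP cf; apply/subspace_continuousP => y By P nP.
have nQ : nbhs (g y) (fun z => A z -> P (f z)) := cf _ (BA _ By) P nP.
have {}nQ : nbhs y (fun t => A (g t) -> P (f (g t))) := cg y _ nQ.
suff : nbhs y (fun t => B t -> P (f (g t))) by [].
by apply: filterS nQ => t At Bt; apply: At; exact: BA.
Qed.

Section PlaneIntegral.
Context {R : realType}.
Local Notation mu := (@lebesgue_measure R).
Local Notation mu2 := (mu \x mu)%E.

(** An open set of the plane is a countable union of open boxes with rational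
    vertices. *)
Lemma open_measurable_plane (U : set (R * R)) : open U -> measurable U.
Proof.
move=> oU.
pose box (a b c d : rat) : set (R * R) :=
  `]ratr a, ratr b[ `*` `]ratr c, ratr d[.
pose F a b c d : set (R * R) :=
  if `[< box a b c d `<=` U >] then box a b c d else set0.
have -> : U = \bigcup_a \bigcup_b \bigcup_c \bigcup_d F a b c d.
  apply/seteqP; split=> [[x y] Uxy|z [a _ [b _ [c _ [d _]]]]]; last first.
    by rewrite /F; case: asboolP => // + bz; apply.
  have : nbhs (x, y) U by exact: open_nbhs_nbhs.
  case=> -[A B] /= [/nbhs_ballP[r /= r0 rA] /nbhs_ballP[s /= s0 sB]] AB.
  have [a /itvP ax] := @rat_in_itvoo R (x - r) x ltac:(lra).
  have [b /itvP bx] := @rat_in_itvoo R x (x + r) ltac:(lra).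
  have [c /itvP cy] := @rat_in_itvoo R (y - s) y ltac:(lra).
  have [d /itvP dy] := @rat_in_itvoo R y (y + s) ltac:(lra).
  exists a => //; exists b => //; exists c => //; exists d => //.
  rewrite /F; case: asboolP => [_|].
    by split; rewrite /= in_itv/= ?ax ?bx ?cy ?dy.
  case=> -[x' y'] [/=]; rewrite !in_itv/= => /andP[ax' xb'] /andP[cy' yd'].
  apply: (AB (x', y')); split => /=.
    apply: rA; rewrite /ball/= ltr_norml; apply/andP; split.
      by rewrite ltrBrDl -ltrBrDr opprK (lt_trans xb')// bx.
    by rewrite ltrBlDr -ltrBlDl (lt_trans _ ax')// ax.
  apply: sB; rewrite /ball/= ltr_norml; apply/andP; split.
    by rewrite ltrBrDl -ltrBrDr opprK (lt_trans yd')// dy.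
  by rewrite ltrBlDr -ltrBlDl (lt_trans _ cy')// cy.
do 4 (apply: bigcupT_measurable_rat => ?).
by rewrite /F; case: asboolP => // _; apply: measurableX; exact: measurable_itv.
Qed.

Lemma continuous_within_measurable_plane (D : set (R * R)) (f : R * R -> R) :
  measurable D -> {within D, continuous f} -> measurable_fun D f.
Proof.
move=> mD /continuousP cf; apply: (measurability _ (RGenOpens.measurableE R)).
move=> _ [_ [a [b ->] <-]].
have /open_subspaceP[V oV VD] :=
  cf _ (interval_open (a := BRight a) (b := BLeft b) isT isT).
by rewrite setIC -VD; apply: measurableI => //; exact: open_measurable_plane.
Qed.

Definition triangle : set (R * R) :=
  [set p | [/\ 0 <= p.1, 0 <= p.2 & p.1 + p.2 <= 1]].

Lemma closed_triangle : closed triangle.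
Proof.
have -> : triangle = (fst @^-1` [set x | 0 <= x]) `&`
   (snd @^-1` [set x | 0 <= x]) `&`
   ((fun p : R * R => p.1 + p.2) @^-1` [set x | x <= 1]).
  by apply/seteqP; split=> p /=; [move=> []|move=> [[]]].
apply: closedI; first apply: closedI.
- by apply: preimage_closed (@closed_ge R 0) => -[a b] _; exact: cvg_fst.
- by apply: preimage_closed (@closed_ge R 0) => -[a b] _; exact: cvg_snd.
- apply: preimage_closed (@closed_le R 1) => -[a b] _.
  by apply: cvgD; [exact: cvg_fst|exact: cvg_snd].
Qed.

Lemma triangle_sub_square : triangle `<=` `[0, 1] `*` `[0, 1].
Proof. by move=> p [p1 p2 p12]; split; rewrite /= in_itv/=; lra. Qed.

Lemma compact_triangle : compact triangle.
Proof.
apply: subclosed_compact closed_triangle _ triangle_sub_square.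
by apply: compact_setX; exact: segment_compact.
Qed.

Lemma measurable_triangle : measurable triangle.
Proof.
rewrite -[triangle]setCK; apply: measurableC; apply: open_measurable_plane.
exact: closed_openC closed_triangle.
Qed.

Lemma integrable_triangle (f : R * R -> R) :
  {within triangle, continuous f} -> mu2.-integrable triangle (EFin \o f).
Proof.
move=> cf; apply: measurable_bounded_integrable.
- exact: measurable_triangle.
- apply: (@le_lt_trans _ _ (mu2 (`[0, 1] `*` `[0, 1]))).
    apply: le_measure; rewrite ?inE.
    - exact: measurable_triangle.
    - exact: measurableX.
    - exact: triangle_sub_square.
  rewrite product_measure1E//= lebesgue_measure_itv/= lte_fin ltr01.
  by rewrite -EFinB -EFinM ltry.
- exact: continuous_within_measurable_plane measurable_triangle _.
- have /compact_bounded[M [_ mrt]] := continuous_compact cf compact_triangle.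
  by exists M; split; rewrite ?num_real // => ? ? ? ?; exact: mrt.
Qed.

Lemma xsection_triangle (f : R * R -> R) x :
  (\int[mu]_y ((EFin \o f) \_ triangle) (x, y)
   = if x \in `[0%R, 1%R]
     then \int[mu]_(y in `[0%R, (1 - x)%R]) (f (x, y))%:E else 0)%E.
Proof.
case: ifPn => x01.
  rewrite [RHS]integral_mkcond; apply: eq_integral => y _.
  rewrite !patchE; congr (if _ then _ else _); apply/idP/idP; rewrite !inE/=.
    by move=> [] /=; rewrite in_itv/= => *; lra.
  by move: x01; rewrite !in_itv/= => *; split => /=; lra.
apply: integral0_eq => y _; rewrite patchE; case: ifPn => //.
rewrite inE => -[/= ? ? ?]; case/negP: x01; rewrite in_itv/=; lra.
Qed.

Lemma ysection_triangle (f : R * R -> R) y :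
  (\int[mu]_x ((EFin \o f) \_ triangle) (x, y)
   = if y \in `[0%R, 1%R]
     then \int[mu]_(x in `[0%R, (1 - y)%R]) (f (x, y))%:E else 0)%E.
Proof.
case: ifPn => y01.
  rewrite [RHS]integral_mkcond; apply: eq_integral => x _.
  rewrite !patchE; congr (if _ then _ else _); apply/idP/idP; rewrite !inE/=.
    by move=> [] /=; rewrite in_itv/= => *; lra.
  by move: y01; rewrite !in_itv/= => *; split => /=; lra.
apply: integral0_eq => x _; rewrite patchE; case: ifPn => //.
rewrite inE => -[/= ? ? ?]; case/negP: y01; rewrite in_itv/=; lra.
Qed.

(** The degenerate segment b = 0 occurs as a slice of the triangle. *)
Lemma FTC2_le (k K : R -> R) (b : R) : 0 <= b ->
  {within `[0, b], continuous k} -> {within `[0, b], continuous K} ->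
  (forall y, 0 < y < b -> is_derive y 1 K (k y)) ->
  (\int[mu]_(y in `[0%R, b]) (k y)%:E = (K b - K 0)%:E)%E.
Proof.
rewrite le_eqVlt => /predU1P[<-|b0] ck cK dK.
  by rewrite subrr set_itv1 integral_set1.
rewrite EFinB; apply: continuous_FTC2 => //.
  have [_ c0 cb] := (continuous_within_itvP K b0).1 cK; split => //.
  by move=> y; rewrite in_itv/= => yb; case: (dK y yb).
by move=> y; rewrite in_itv/= => yb; rewrite derive1E; case: (dK y yb).
Qed.

Lemma pair_continuous (f g : R -> R) :
  continuous f -> continuous g -> continuous (fun t => (f t, g t)).
Proof. by move=> cf cg t; exact: (cvg_pair (cf t) (cg t)). Qed.

Lemma vertical_continuous (x : R) : continuous (fun y : R => (x, y)).
Proof. by apply: pair_continuous => y; [exact: cvg_cst|exact: cvg_id]. Qed.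

Lemma horizontal_continuous (y : R) : continuous (fun x : R => (x, y)).
Proof. by apply: pair_continuous => x; [exact: cvg_id|exact: cvg_cst]. Qed.

(** Fubini's theorem, then the fundamental theorem of calculus on each vertical
    slice. *)
Lemma FTC_triangle_y (f F : R * R -> R) :
  {within triangle, continuous f} -> {within triangle, continuous F} ->
  (forall x y : R, 0 <= x -> 0 < y -> x + y < 1 ->
     is_derive y 1 (fun t => F (x, t)) (f (x, y))) ->
  \int[mu2]_(p in triangle) f p =
  \int[mu]_(x in `[0, 1]) (F (x, 1 - x) - F (x, 0)).
Proof.
move=> cf cF dF; congr fine.
rewrite integral_mkcond -integral12_prod_meas1; last first.
  have mT := integrable_mkcond (mu := mu2) (EFin \o f) measurable_triangle.
  exact: mT.1 (integrable_triangle cf).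
rewrite [RHS]integral_mkcond; apply: eq_integral => x _.
rewrite [LHS]xsection_triangle patchE mem_setE; case: ifPn => // x01.
have slice y : y \in `[0, 1 - x] -> triangle (x, y).
  by move: x01; rewrite !in_itv/= => *; split => /=; lra.
apply: (FTC2_le (K := fun y => F (x, y))).
- by move: x01; rewrite in_itv/= => ?; lra.
- exact: within_continuous_compr (@vertical_continuous x) slice cf.
- exact: within_continuous_compr (@vertical_continuous x) slice cF.
- by move=> y y01; apply: dF; move: x01; rewrite in_itv/= => ?; lra.
Qed.

Lemma FTC_triangle_x (f F : R * R -> R) :
  {within triangle, continuous f} -> {within triangle, continuous F} ->
  (forall x y : R, 0 < x -> 0 <= y -> x + y < 1 ->
     is_derive x 1 (fun t => F (t, y)) (f (x, y))) ->
  \int[mu2]_(p in triangle) f p =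
  \int[mu]_(y in `[0, 1]) (F (1 - y, y) - F (0, y)).
Proof.
move=> cf cF dF; congr fine.
rewrite integral_mkcond -integral21_prod_meas1; last first.
  have mT := integrable_mkcond (mu := mu2) (EFin \o f) measurable_triangle.
  exact: mT.1 (integrable_triangle cf).
rewrite [RHS]integral_mkcond; apply: eq_integral => y _.
rewrite [LHS]ysection_triangle patchE mem_setE; case: ifPn => // y01.
have slice x : x \in `[0, 1 - y] -> triangle (x, y).
  by move: y01; rewrite !in_itv/= => *; split => /=; lra.
apply: (FTC2_le (K := fun x => F (x, y))).
- by move: y01; rewrite in_itv/= => ?; lra.
- exact: within_continuous_compr (@horizontal_continuous y) slice cf.
- exact: within_continuous_compr (@horizontal_continuous y) slice cF.
- by move=> x x01; apply: dF; move: y01; rewrite in_itv/= => ?; lra.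
Qed.

Lemma Rintegral_itv01_onem (G : R -> R) :
  {within `[0, 1], continuous G} ->
  \int[mu]_(x in `[0, 1]) G (1 - x) = \int[mu]_(x in `[0, 1]) G x.
Proof.
move=> cG; have r01 : 0 <= (1 : R) <= 1 by rewrite ler01 lexx.
have := Rintegration_by_substitution_onem r01 cG.
by rewrite onem1 => ->.
Qed.

(** The two terms P and Q come from slices in the two directions.  Both give a
    function on the hypotenuse, parametrized by t |-> (t, 1 - t) for P and by
    t |-> (1 - t, t) for Q, whence a reflection of the unit segment. *)
Lemma green_triangle (P Q Py Qx : R * R -> R) :
  {within triangle, continuous P} -> {within triangle, continuous Q} ->
  {within triangle, continuous Py} -> {within triangle, continuous Qx} ->
  (forall x y : R, 0 <= x -> 0 < y -> x + y < 1 ->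
     is_derive y 1 (fun t => P (x, t)) (Py (x, y))) ->
  (forall x y : R, 0 < x -> 0 <= y -> x + y < 1 ->
     is_derive x 1 (fun t => Q (t, y)) (Qx (x, y))) ->
  \int[mu2]_(p in triangle) (Qx p - Py p) =
  \int[mu]_(t in `[0, 1]) (Q (1 - t, t) - P (1 - t, t))
  - \int[mu]_(t in `[0, 1]) Q (0, t) + \int[mu]_(t in `[0, 1]) P (t, 0).
Proof.
move=> cP cQ cPy cQx dP dQ.
rewrite RintegralB; [|exact: measurable_triangle|exact: integrable_triangle..].
rewrite (FTC_triangle_x cQx cQ dQ) (FTC_triangle_y cPy cP dP).
have cont (H : R * R -> R) (g : R -> R * R) : continuous g ->
    (forall t, t \in `[0, 1] -> triangle (g t)) ->
    {within triangle, continuous H} -> {within `[0, 1], continuous (H \o g)}.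
  by move=> cg gT cH; exact: within_continuous_compr cg gT cH.
have int (G : R -> R) : {within `[0, 1], continuous G} ->
    mu.-integrable `[0, 1] (EFin \o G).
  move=> cG; apply: continuous_compact_integrable => //.
  exact: segment_compact.
pose d1 t : R * R := (1 - t, t); pose d2 t : R * R := (t, 1 - t).
have conem : continuous (fun t : R => 1 - t).
  by move=> t; apply: cvgB; [exact: cvg_cst|exact: cvg_id].
have cd1 : continuous d1 by apply: pair_continuous => // t; exact: cvg_id.
have cd2 : continuous d2 by apply: pair_continuous => // t; exact: cvg_id.
have T1 t : t \in `[0, 1] -> triangle (d1 t).
  by rewrite in_itv/= => ?; split => /=; lra.
have T2 t : t \in `[0, 1] -> triangle (d2 t).
  by rewrite in_itv/= => ?; split => /=; lra.
have T3 t : t \in `[0, 1] -> triangle (t, 0).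
  by rewrite in_itv/= => ?; split => /=; lra.
have T4 t : t \in `[0, 1] -> triangle (0, t).
  by rewrite in_itv/= => ?; split => /=; lra.
have iQ1 := int _ (cont _ _ cd1 T1 cQ).
have iP1 := int _ (cont _ _ cd1 T1 cP).
have iP2 := int _ (cont _ _ cd2 T2 cP).
have iP3 := int _ (cont _ _ (@horizontal_continuous 0) T3 cP).
have iQ4 := int _ (cont _ _ (@vertical_continuous 0) T4 cQ).
rewrite (RintegralB _ iQ1 iQ4)// (RintegralB _ iP2 iP3)//.
rewrite (RintegralB _ iQ1 iP1)//.
have -> : \int[mu]_(t in `[0, 1]) P (1 - t, t) =
    \int[mu]_(t in `[0, 1]) P (t, 1 - t).
  rewrite -(Rintegral_itv01_onem (cont _ _ cd2 T2 cP)).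
  by apply: eq_Rintegral => t _ /=; rewrite /d2 subKr.
by rewrite opprB addrA addrAC -!addrA; congr (_ + _); rewrite addrC addrA addrAC.
Qed.

End PlaneIntegral.

(** * Stokes' formula for singular triangles *)

Section Affine.
Context {R : realType}.

Lemma is_Cinfty_affine m n (O : set 'rV[R]_m) (L : 'M[R]_(m, n)) c :
  open O -> is_Cinfty O (fun x => x *m L + c).
Proof.
move=> oO k; apply: is_CkD => //; last exact: is_Ck_cst.
apply: is_Ck_mulmx => //; last exact: is_Ck_cst.
apply: (@is_Ck_linear R k _ _ O (idfun : {linear 'rV[R]_m -> 'rV[R]_m})) => //.
by move=> x; exact: cvg_id.
Qed.

Lemma derive_affine m n (L : 'M[R]_(m, n)) c x v :
  'D_v (fun x : 'rV[R]_m => x *m L + c) x = v *m L.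
Proof.
have cL : continuous (mulmxr L : 'rV[R]_m -> 'rV[R]_n).
  move=> y; have := @is_Cinfty_affine m n setT L 0 openT 0%N y I.
  rewrite (_ : (fun x => x *m L + 0) = mulmxr L)//.
  by apply/funext => z; rewrite addr0.
have dL : differentiable (mulmxr L : 'rV[R]_m -> 'rV[R]_n) x.
  exact: linear_differentiable.
rewrite [LHS](_ : _ = 'D_v ((mulmxr L : 'rV[R]_m -> 'rV[R]_n) + cst c) x)//.
rewrite deriveD; [|exact: diff_derivable|exact: derivable_cst].
by rewrite derive_cst addr0 deriveE// diff_lin.
Qed.

Lemma jacobian_affine m n (L : 'M[R]_(m, n)) c x :
  jacobian (fun x => x *m L + c) x = L.
Proof.
have da := is_Cinfty_differentiable (is_Cinfty_affine L c openT) (I : setT x).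
apply/row_matrixP => i; rewrite [LHS]rowE [RHS]rowE.
by rewrite -(derive_affine L c x) deriveEjacobian.
Qed.

End Affine.
Section GreenSimplex.
Context {R : realType}.
Local Notation mu := (@lebesgue_measure R).
Local Notation mu2 := (mu \x mu)%E.

(** The hypothesis is about the line only: the segment may run inside the
    boundary of D, as the slice of the triangle along an edge does. *)
Lemma derive_within_line (V W : normedModType R) (D : set V) (b : V -> W)
    v y (t : R) : regular_dom D -> smooth_within D b ->
  (\forall s \near t, D (s *: v + y)) ->
  is_derive t 1 (fun s => b (s *: v + y)) (derive_within D b (t *: v + y) v).
Proof.
move=> rD sb Ds; have Dt := nbhs_singleton Ds.
have [g gb] := sb _ Dt; rewrite (derive_withinE v rD Dt gb).
have [ O [oO Ot cg gbO]] := gb.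
apply: (@near_eq_is_derive _ _ _ (fun s : R => g (s *: v + y))); last first.
  by apply: derive_line; exact: is_Cinfty_differentiable cg Ot.
have cl : s *: v + y @[s --> t] --> t *: v + y.
  by apply: cvgD; [apply: cvgZr_tmp; exact: cvg_id|exact: cvg_cst].
have nO : \forall s \near t, O (s *: v + y) by apply: cl; exact: open_nbhs_nbhs.
by apply: filterS2 nO Ds => s; exact: gbO.
Qed.

Lemma plane_ptE (p : R * R) :
  plane_pt p = p.1 *: delta_mx 0 ord0 + p.2 *: delta_mx 0 ord_max.
Proof.
apply/rowP => j; rewrite !mxE/=; case: j => [[|[|//]] ?] /=.
  by rewrite mulr1 mulr0 addr0.
by rewrite mulr1 mulr0 add0r.
Qed.

Lemma plane_pt_vertical (x t : R) :
  plane_pt (x, t) = t *: delta_mx 0 ord_max + x *: delta_mx 0 ord0.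
Proof. by rewrite plane_ptE addrC. Qed.

Lemma plane_pt_continuous : continuous (@plane_pt R).
Proof.
move=> -[x y]; rewrite (funext plane_ptE).
apply: (@cvgD _ _ _ (nbhs (x, y)) _
  (fun p : R * R => p.1 *: delta_mx 0 ord0 : 'rV[R]_2)
  (fun p : R * R => p.2 *: delta_mx 0 ord_max : 'rV[R]_2)).
  by apply: cvgZr_tmp; exact: cvg_fst.
by apply: cvgZr_tmp; exact: cvg_snd.
Qed.

Lemma simplex2E : @plane_pt R @^-1` @std_simplex R 2 = triangle.
Proof.
apply/seteqP; split=> -[x y]; rewrite /std_simplex /=.
  move=> [pos]; rewrite !big_ord_recl big_ord0 !mxE/= addr0 => le1.
  by have := pos ord0; have := pos ord_max; rewrite !mxE/=.
move=> [/= x0 y0 xy]; split; last by rewrite !big_ord_recl big_ord0 !mxE/= addr0.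
by move=> j; rewrite mxE; case: ifP.
Qed.

(** Green's formula for the coefficients of a one-form that is smooth up to the
    boundary of the standard simplex. *)
Lemma green_simplex (b : 'rV[R]_2 -> 'cV[R]_2) :
  smooth_within (@std_simplex R 2) b ->
  \int[mu2]_(p in plane_pt @^-1` @std_simplex R 2)
    curl (@std_simplex R 2) b (plane_pt p) ord0 ord_max =
  \int[mu]_(t in `[0, 1])
     (b (plane_pt (1 - t, t)) ord_max 0 - b (plane_pt (1 - t, t)) ord0 0)
  - \int[mu]_(t in `[0, 1]) b (plane_pt (0, t)) ord_max 0
  + \int[mu]_(t in `[0, 1]) b (plane_pt (t, 0)) ord0 0.
Proof.
move=> sb; rewrite simplex2E; have rT := @regular_simplex R 2.
have sbl l : smooth_within (@std_simplex R 2) (fun z => b z l 0).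
  move=> z /sb[g gb]; exists (fun z => g z l 0).
  exact: smooth_extension_entry.
pose bd l k z :=
  derive_within (@std_simplex R 2) (fun z => b z l 0) z (delta_mx 0 k).
have ct (F : 'rV[R]_2 -> R) : smooth_within (@std_simplex R 2) F ->
    {within triangle, continuous (F \o plane_pt)}.
  move=> /smooth_within_continuous; apply: within_continuous_compr.
    exact: plane_pt_continuous.
  by move=> p; rewrite -simplex2E.
under eq_Rintegral do rewrite mxE.
apply: (green_triangle (P := fun p => b (plane_pt p) ord0 0)
  (Q := fun p => b (plane_pt p) ord_max 0)
  (Py := fun p => bd ord0 ord_max (plane_pt p))
  (Qx := fun p => bd ord_max ord0 (plane_pt p))).
- exact: ct (sbl ord0).
- exact: ct (sbl ord_max).
- exact: ct (smooth_within_derive _ rT (sbl ord0)).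
- exact: ct (smooth_within_derive _ rT (sbl ord_max)).
- move=> x y x0 y0 xy; rewrite /bd plane_pt_vertical.
  rewrite (_ : (fun t => _) = fun t : R => (fun z => b z ord0 0)
    (t *: delta_mx 0 ord_max + x *: delta_mx 0 ord0)); last first.
    by apply/funext => t; rewrite plane_pt_vertical.
  apply: derive_within_line (sbl ord0) _ => //; near=> t.
  suff : (plane_pt @^-1` @std_simplex R 2) (x, t) by rewrite /= plane_pt_vertical.
  have t0 : 0 < t by near: t; exact: lt_nbhsr.
  have t1 : t < 1 - x by near: t; apply: lt_nbhsl; lra.
  by rewrite simplex2E; split => /=; lra.
- move=> x y x0 y0 xy; rewrite /bd plane_ptE.
  rewrite (_ : (fun t => _) = fun t : R => (fun z => b z ord_max 0)
    (t *: delta_mx 0 ord0 + y *: delta_mx 0 ord_max)); last first.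
    by apply/funext => t; rewrite plane_ptE.
  apply: derive_within_line (sbl ord_max) _ => //; near=> t.
  suff : (plane_pt @^-1` @std_simplex R 2) (t, y) by rewrite /= plane_ptE.
  have t0 : 0 < t by near: t; exact: lt_nbhsr.
  have t1 : t < 1 - y by near: t; apply: lt_nbhsl; lra.
  by rewrite simplex2E; split => /=; lra.
Unshelve. all: by end_near. Qed.

End GreenSimplex.

Section Faces.
Context {R : realType}.

(** The differential of the affine map face_pt i. *)
Definition face_dir (i : 'I_3) : 'rV[R]_2 :=
  vertex (lift i ord_max) - vertex (lift i ord0).

Lemma face_pt_affine (i : 'I_3) (x : 'rV[R]_1) :
  face_pt i x = x *m face_dir i + vertex (lift i ord0).
Proof.
rewrite /face_pt !big_ord_recl big_ord0 addr0 /bary unlift_none.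
rewrite (_ : lift ord0 ord0 = ord_max :> 'I_2); last exact: val_inj.
rewrite (_ : ord_max = lift ord0 ord0 :> 'I_2); last exact: val_inj.
rewrite liftK !big_ord_recl big_ord0 addr0 {3}[x]mx11_scalar mul_scalar_mx.
rewrite /face_dir (_ : ord_max = lift ord0 ord0 :> 'I_2); last exact: val_inj.
by rewrite scalerBl scale1r scalerBr addrC addrAC addrA.
Qed.

Lemma vertex0 k : vertex (ord0 : 'I_k.+1) = 0 :> 'rV[R]_k.
Proof. by rewrite /vertex unlift_none. Qed.

Lemma vertex_lift k (l : 'I_k) :
  vertex (lift ord0 l) = delta_mx 0 l :> 'rV[R]_k.
Proof. by rewrite /vertex liftK. Qed.

Lemma triangle_face0 : face_dir ord0 = delta_mx 0 ord_max - delta_mx 0 ord0 /\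
  forall t : R, face_pt ord0 (const_mx t) = plane_pt (1 - t, t).
Proof.
have d : face_dir ord0 = delta_mx 0 ord_max - delta_mx 0 ord0.
  by rewrite /face_dir !vertex_lift.
split=> // t; rewrite face_pt_affine d vertex_lift plane_ptE/=.
apply/rowP => j; rewrite !mxE big_ord_recl big_ord0 !mxE; ring.
Qed.

Lemma triangle_face1 : face_dir (lift ord0 ord0) = delta_mx 0 ord_max /\
  forall t : R, face_pt (lift ord0 ord0 : 'I_3) (const_mx t) = plane_pt (0, t).
Proof.
have l0 : lift (lift ord0 ord0 : 'I_3) (ord0 : 'I_2) = ord0 by exact: val_inj.
have l1 : lift (lift ord0 ord0 : 'I_3) (ord_max : 'I_2) = lift ord0 ord_max.
  exact: val_inj.
have d : face_dir (lift ord0 ord0) = delta_mx 0 ord_max.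
  by rewrite /face_dir l0 l1 vertex_lift vertex0 subr0.
split=> // t; rewrite face_pt_affine d l0 vertex0 plane_ptE/=.
apply/rowP => j; rewrite !mxE big_ord_recl big_ord0 !mxE; ring.
Qed.

Lemma triangle_face2 : face_dir (lift ord0 (lift ord0 ord0)) = delta_mx 0 ord0 /\
  forall t : R, face_pt (lift ord0 (lift ord0 ord0) : 'I_3) (const_mx t)
            = plane_pt (t, 0).
Proof.
have l0 : lift (lift ord0 (lift ord0 ord0) : 'I_3) (ord0 : 'I_2) = ord0.
  exact: val_inj.
have l1 : lift (lift ord0 (lift ord0 ord0) : 'I_3) (ord_max : 'I_2)
    = lift ord0 ord0 by exact: val_inj.
have d : face_dir (lift ord0 (lift ord0 ord0)) = delta_mx 0 ord0.
  by rewrite /face_dir l0 l1 vertex_lift vertex0 subr0.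
split=> // t; rewrite face_pt_affine d l0 vertex0 plane_ptE/=.
apply/rowP => j; rewrite !mxE big_ord_recl big_ord0 !mxE; ring.
Qed.

Lemma simplex1P (t : R) : t \in `[0, 1] -> @std_simplex R 1 (const_mx t).
Proof.
rewrite in_itv/= => /andP[t0 t1]; split; first by move=> i; rewrite mxE.
by rewrite big_ord_recl big_ord0 mxE addr0.
Qed.

End Faces.

Section Stokes.
Context {R : realType} {n : nat} {M : Type} {A : atlas R n M}.
Local Notation mu := (@lebesgue_measure R).
Local Notation mu2 := (mu \x mu)%E.
Context (a : pre_form1 A).
Hypotheses (cA : compatible_charts A) (fa : is_form1 a).

Lemma pullback1_affine k k' (D : set 'rV[R]_k) (D' : set 'rV[R]_k')
    (f : D -> M) (f' : D' -> M) (L : 'M[R]_(k', k)) c x :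
  regular_dom D -> regular_dom D' -> D' x -> smooth_into A f ->
  (forall y, D' y -> D (y *m L + c)) ->
  (forall (y' : D') (y : D), \val y = \val y' *m L + c -> f' y' = f y) ->
  pullback1 a f' x = L *m pullback1 a f (x *m L + c).
Proof.
move=> rD rD' D'x sf D'D ff'.
have [j [u lu]] := sf _ (D'D _ D'x).
have lu' := local_expr_comp openT (I : setT x) (is_Cinfty_affine L c openT)
  (fun y _ => D'D y) ff' lu.
rewrite (pullback1E cA fa rD' D'x lu') (pullback1E cA fa rD (D'D _ D'x) lu).
have da := is_Cinfty_differentiable (is_Cinfty_affine L c openT) (I : setT x).
have [ O [oO Ox cu _]] := lu; have du := is_Cinfty_differentiable cu Ox.
have J1 := jacobian_comp da du; rewrite jacobian_affine in J1.
apply: etrans (congr1 (mulmx ^~ (a j (u (x *m L + c)))) J1) _.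
exact: esym (mulmxA _ _ _).
Qed.

Definition int_edge (f : @std_simplex R 1 -> M) : R :=
  \int[mu]_(t in `[0, 1]) pullback1 a f (const_mx t) 0 0.

Lemma int_edge_face (f : @std_simplex R 2 -> M) (i : 'I_3) : smooth_into A f ->
  int_edge (f \o face i) = \int[mu]_(t in `[0, 1])
    (face_dir i *m pullback1 a f (face_pt i (const_mx t))) 0 0.
Proof.
move=> sf; apply: eq_Rintegral => t; rewrite inE/= => t01.
rewrite face_pt_affine -(pullback1_affine (f' := f \o face i)) //.
- exact: regular_simplex.
- exact: regular_simplex.
- exact: simplex1P.
- move=> y Dy; rewrite -face_pt_affine.
  by have := face_ptP i (in_dom Dy); rewrite inE.
- move=> y' y yE; rewrite /= ; congr f; apply: val_inj.
  by rewrite /= face_pt_affine -yE.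
Qed.

Lemma sum_face_sign (F : 'I_3 -> R) :
  \sum_(i < 3) F i *~ (-1) ^+ i =
  F ord0 - F (lift ord0 ord0) + F (lift ord0 (lift ord0 ord0)).
Proof.
rewrite !big_ord_recl big_ord0 addr0 /= expr0 expr1 mulr1z mulrN1z.
by rewrite expr2 mulN1r opprK mulr1z addrA.
Qed.

(** The curl of the pull-back of a is the pull-back of d a, and Green's formula
    turns its integral into integrals over the three edges. *)
Theorem stokes (f : @std_simplex R 2 -> M) : smooth_into A f ->
  \int[mu2]_(p in plane_pt @^-1` @std_simplex R 2)
    pullback2 f (ext_d1 a) (plane_pt p) ord0 ord_max
  = \sum_(i < 3) int_edge (f \o face i) *~ (-1) ^+ i.
Proof.
move=> sf; have rT := @regular_simplex R 2.
transitivity (\int[mu2]_(p in plane_pt @^-1` @std_simplex R 2)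
    curl (@std_simplex R 2) (pullback1 a f) (plane_pt p) ord0 ord_max).
  apply: eq_Rintegral => p; rewrite inE => Tp.
  by rewrite (pullback2_ext_d1 cA fa rT sf Tp).
rewrite (green_simplex (smooth_pullback1 cA fa rT sf)).
rewrite sum_face_sign !int_edge_face//.
have [d0 p0] := @triangle_face0 R; have [d1 p1] := @triangle_face1 R.
have [d2 p2] := @triangle_face2 R.
congr (_ - _ + _); apply: eq_Rintegral => t _.
- by rewrite p0 d0 mulmxBl -!rowE !mxE.
- by rewrite p1 d1 -rowE mxE.
- by rewrite p2 d2 -rowE mxE.
Qed.

End Stokes.

(** * The cylinder over a manifold *)

Section RowMx.
Context {R : realType}.

Lemma is_Ck_row_mx r (V : normedModType R) m n1 n2 (O : set V)
    (F : V -> 'M[R]_(m, n1)) (G : V -> 'M[R]_(m, n2)) : open O ->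
  is_Ck r O F -> is_Ck r O G -> is_Ck r O (fun x => row_mx (F x) (G x)).
Proof.
move=> oO /(is_Ck_mxP _ _ oO) cF /(is_Ck_mxP _ _ oO) cG.
apply/(is_Ck_mxP _ _ oO) => i j; case: (split_ordP j) => l ->.
  by under eq_fun do rewrite row_mxEl; exact: cF.
by under eq_fun do rewrite row_mxEr; exact: cG.
Qed.

Lemma jacobian_entry m n (u : 'rV[R]_m -> 'rV[R]_n) x i j :
  differentiable u x ->
  jacobian u x i j = 'D_(delta_mx 0 i) (fun y => u y 0 j) x.
Proof.
move=> du; apply: etrans (jacobianE i j du) _.
by rewrite derive_mx ?mxE//; exact: diff_derivable.
Qed.

Lemma jacobian_row_mx m n1 n2 (F : 'rV[R]_m -> 'rV[R]_n1)
    (G : 'rV[R]_m -> 'rV[R]_n2) x :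
  differentiable F x -> differentiable G x ->
  differentiable (fun y => row_mx (F y) (G y)) x ->
  jacobian (fun y => row_mx (F y) (G y)) x = row_mx (jacobian F x) (jacobian G x).
Proof.
move=> dF dG dFG; apply/matrixP => i j.
rewrite (jacobian_entry i j dFG); case: (split_ordP j) => l ->.
  rewrite [RHS]row_mxEl.
  rewrite [RHS](jacobian_entry i l dF).
  have -> : (fun y => row_mx (F y) (G y) 0 (lshift n2 l)) = (fun y => F y 0 l).
    by apply/funext => y; rewrite row_mxEl.
  by [].
rewrite [RHS]row_mxEr [RHS](jacobian_entry i l dG).
have -> // : (fun y => row_mx (F y) (G y) 0 (rshift n1 l)) = (fun y => G y 0 l).
by apply/funext => y; rewrite row_mxEr.
Qed.

Lemma is_Cinfty_rsubmx m n (O : set 'rV[R]_(m + n)) :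
  open O -> is_Cinfty O (@rsubmx R 1 m n).
Proof.
have -> : @rsubmx R 1 m n = fun x => x *m col_mx 0 1%:M + 0.
  by apply/funext => x; rewrite -{2}[x]hsubmxK mul_row_col mulmx0 mulmx1 add0r addr0.
exact: is_Cinfty_affine.
Qed.

Lemma is_Cinfty_lsubmx m n (O : set 'rV[R]_(m + n)) :
  open O -> is_Cinfty O (@lsubmx R 1 m n).
Proof.
have -> : @lsubmx R 1 m n = fun x => x *m col_mx 1%:M 0 + 0.
  by apply/funext => x; rewrite -{2}[x]hsubmxK mul_row_col mulmx0 mulmx1 addr0 addr0.
exact: is_Cinfty_affine.
Qed.

Lemma open_window (V : normedModType R) (O : set V) (F : V -> 'rV[R]_1) (b : R) :
  open O -> is_Cinfty O F -> open (O `&` [set y | b < F y 0 0 < b + 1]).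
Proof.
move=> oO cF.
have -> : [set y | b < F y 0 0 < b + 1] =
    (fun y => F y 0 0) @^-1` `]b, b + 1[%classic.
  by apply/seteqP; split => y; rewrite /= in_itv.
apply: open_setI_preimage => // y Oy.
exact: ((is_Ck_mxP _ _ oO).1 (cF 0%N) 0 0).
Qed.

End RowMx.

Section Cylinder.
Context {R : realType} {n : nat} {S : Type} (A : atlas R n S).

(** The charts of the mapping torus before passing to the quotient.  A one-form
    on the mapping torus is in particular one on the cylinder S x R, where two
    charts that meet are related by a transition of the charts of S alone. *)
Definition cylinder_atlas : atlas R (1 + n) (S * R) :=
  @Atlas R (1 + n) (S * R) (pidx A * R)%type
    (fun ia => [set y : 'rV_(1 + n) | pdom ia.1 (rsubmx y) /\
                                      ia.2 < lsubmx y 0 0 < ia.2 + 1])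
    (fun ia (y : 'rV_(1 + n)) => (par ia.1 (rsubmx y), lsubmx y 0 0)).

(** Any window ]b, b + 1[ that contains the height tau x gives a chart of the
    cylinder in which the map is expressed by tau and u. *)
Lemma local_expr_cylinder k (D : set 'rV[R]_k) (f : D -> S) (f' : D -> S * R)
    x (j : pidx A) b u (tau : 'rV[R]_k -> 'rV[R]_1) O :
  open O -> O x -> is_Cinfty O tau -> b < tau x 0 0 < b + 1 ->
  (forall y, f' y = (f y, tau (\val y) 0 0)) ->
  local_expr f x j u ->
  local_expr f' x ((j, b) : pidx cylinder_atlas) (fun y => row_mx (tau y) (u y)).
Proof.
move=> oO Ox ct bx f'E [ O' [oO' O'x cu fu]].
have oO2 : open (O `&` O' `&` [set y | b < tau y 0 0 < b + 1]).
  apply: open_window; first exact: openI.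
  by apply: is_Cinfty_sub ct => y [].
exists (O `&` O' `&` [set y | b < tau y 0 0 < b + 1]); split => //.
  move=> r; apply: is_Ck_row_mx => //.
    by apply: is_Ck_sub (ct r) => y [[]].
  by apply: is_Ck_sub (cu r) => y [[]].
move=> y [[Oy O'y] /= wy]; have [Ey pE] := fu y O'y.
by rewrite row_mxKr row_mxKl f'E -pE.
Qed.

Lemma regular_cylinder (D : set 'rV[R]_n) (b : R) : regular_dom D ->
  regular_dom [set y : 'rV[R]_(1 + n) | D (rsubmx y) /\ b < lsubmx y 0 0 < b + 1].
Proof.
move=> rD y [Dy wy] B nB.
have cr : row_mx (lsubmx y) z @[z --> rsubmx y] --> y.
  have cw : is_Ck 0 setT (fun z : 'rV[R]_n => row_mx (lsubmx y) z).
    apply: is_Ck_row_mx; [exact: openT|exact: is_Ck_cst openT|].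
    by move=> z _; exact: cvg_id.
  by rewrite -[X in _ --> X]hsubmxK; exact: cw (rsubmx y) I.
have [z [Dz Bz]] := rD _ Dy _ (cr B nB).
exists (row_mx (lsubmx y) z); split => //.
have oW := open_window b openT (is_Cinfty_lsubmx (m := 1) (n := n) openT).
have : nbhs (row_mx (lsubmx y) z) (setT `&`
    [set y : 'rV[R]_(1 + n) | b < lsubmx y 0 0 < b + 1]).
  by apply: open_nbhs_nbhs; split => //; split => //=; rewrite row_mxKl.
have : nbhs (row_mx (lsubmx y) z) (@rsubmx R 1 1 n @^-1` D).
  have cR := is_Cinfty_continuous (is_Cinfty_rsubmx (m := 1) (n := n) openT)
    (I : setT (row_mx (lsubmx y) z)).
  by apply: cR; rewrite row_mxKr.
by move=> n1 n2; apply: filterS2 n1 n2 => z' Dz' [].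
Qed.

Lemma compatible_cylinder : compatible_charts A -> compatible_charts cylinder_atlas.
Proof.
move=> [rA iA tA]; split => [[i b]|[i b] x y [/= Dx _] [Dy _] [pE tE]|].
- exact: regular_cylinder.
- rewrite -[x]hsubmxK -[y]hsubmxK (iA _ _ _ Dx Dy pE).
  by congr row_mx; apply/rowP => l; rewrite ord1.
move=> [i b] [j c] x y [/= Dx wx] [/= Dy wy] [pE tE].
have [phi lphi] := tA i j _ _ Dx Dy pE.
exists (fun z => row_mx (lsubmx z) (phi (rsubmx z))).
pose f : [set y : 'rV_(1 + n) | pdom i (rsubmx y) /\
    b < lsubmx y 0 0 < b + 1] -> S := fun z => par i (rsubmx (\val z)).
apply: (local_expr_cylinder (f := f) openT I (is_Cinfty_lsubmx openT)) => //.
- by rewrite tE.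
- apply: (local_expr_comp openT I (is_Cinfty_rsubmx openT) _ _ lphi).
    by move=> z _ [].
  by move=> z z' zz'; rewrite /f /par_on zz'.
Qed.

Lemma smooth_into_cylinder k (D : set 'rV[R]_k) (f : D -> S) (f' : D -> S * R)
    (tau : 'rV[R]_k -> 'rV[R]_1) :
  is_Cinfty setT tau -> (forall y, f' y = (f y, tau (\val y) 0 0)) ->
  smooth_into A f -> smooth_into cylinder_atlas f'.
Proof.
move=> ct f'E sf x /sf[j [u lu]].
(* A window centred at the height of the point. *)
exists (j, tau x 0 0 - 1 / 2), (fun y => row_mx (tau y) (u y)).
apply: (local_expr_cylinder openT I ct _ f'E lu); lra.
Qed.

End Cylinder.

(** * The strip swept by an edge *)

Section Prism.
Context {R : realType} {n : nat} {S : Type} {A : atlas R n S}.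
Context (beta : pre_form1 (cylinder_atlas A)).
Hypotheses (cA : compatible_charts A) (fbeta : is_form1 beta).
Hypothesis vert : forall (ia : pidx (cylinder_atlas A)) y, pdom ia y ->
  forall l, ext_d1 beta ia y (lshift n ord0) l = 0.

Lemma ext_d1_asym k M (B : atlas R k M) (a : pre_form1 B) i x r l :
  ext_d1 a i x r l = - ext_d1 a i x l r.
Proof. by rewrite !mxE opprB. Qed.

(** By antisymmetry the vanishing of the first row, which is the contraction of
    d beta with d/dt, entails that of the first column. *)
Lemma ext_d1_block (ia : pidx (cylinder_atlas A)) y : pdom ia y ->
  ext_d1 beta ia y = block_mx 0 0 0 (drsubmx (ext_d1 beta ia y)).
Proof.
move=> Dy; rewrite -[LHS](@submxK _ 1 n 1 n); congr block_mx.
- apply/matrixP => r l; rewrite (ord1 r) [LHS]mxE [in LHS]mxE [RHS]mxE.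
  exact: vert.
- apply/matrixP => r l; rewrite (ord1 r) [LHS]mxE [in LHS]mxE [RHS]mxE.
  exact: vert.
- apply/matrixP => r l; rewrite (ord1 l) [LHS]mxE [in LHS]mxE [RHS]mxE.
  by rewrite ext_d1_asym vert ?oppr0.
Qed.

(** A singular triangle contained in the strip swept by s: L gives the parameter
    along s and tau the height, as linear functions on the triangle. *)
Definition prism (s : @std_simplex R 1 -> S) (L tau : 'M[R]_(2, 1))
    (HL : forall z, @std_simplex R 2 z -> @std_simplex R 1 (z *m L))
    (z : @std_simplex R 2) : S * R :=
  (s (in_dom (HL _ (set_valP z))), (\val z *m tau) 0 0).

Lemma antisymmetric_mx11 (Z : 'M[R]_1) : Z^T = - Z -> Z = 0.
Proof.
move=> /matrixP /(_ 0 0); rewrite !mxE => /eqP.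
rewrite -addr_eq0 -mulr2n mulrn_eq0/= => /eqP Z0.
by apply/matrixP => i j; rewrite !ord1 Z0 mxE.
Qed.

Lemma smooth_prism s L tau HL : smooth_into A s ->
  smooth_into (cylinder_atlas A) (@prism s L tau HL).
Proof.
move=> ss; pose sL (z : @std_simplex R 2) := s (in_dom (HL _ (set_valP z))).
apply: (smooth_into_cylinder (f := sL) (is_Cinfty_affine tau 0 openT)).
  by move=> y; rewrite addr0.
move=> z Tz; have [j [u lu]] := ss _ (HL _ Tz).
exists j, (u \o fun y => y *m L + 0).
apply: (local_expr_comp (f := s) openT I (is_Cinfty_affine L 0 openT)).
- by move=> y _ Ty; rewrite addr0; exact: (HL y Ty).
- move=> y' y yE; rewrite /sL; apply: (congr1 s); apply: val_inj.
  by rewrite /= yE addr0.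
- by rewrite addr0.
Qed.

(** Only the component of d beta along S matters, and it is pulled back through
    the one-dimensional edge s, on which every two-form is zero. *)
Lemma pullback2_prism s L tau HL z : smooth_into A s -> @std_simplex R 2 z ->
  pullback2 (@prism s L tau HL) (ext_d1 beta) z = 0.
Proof.
move=> ss Tz; have rT k := @regular_simplex R k.
pose sL (z : @std_simplex R 2) := s (in_dom (HL _ (set_valP z))).
have cc := compatible_cylinder cA.
have [j [u lu]] := ss _ (HL _ Tz).
pose alL y : 'rV[R]_1 := y *m L + 0; pose alT y : 'rV[R]_1 := y *m tau + 0.
have lu1 : local_expr s (alL z) j u by rewrite /alL addr0.
have cL := is_Cinfty_affine L 0 (openT : open [set: 'rV[R]_2]).
have cT := is_Cinfty_affine tau 0 (openT : open [set: 'rV[R]_2]).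
have lu2 : local_expr sL z j (u \o alL).
  apply: (local_expr_comp (f := s) openT I cL) lu1.
    by move=> y _ Ty; rewrite addr0; exact: (HL y Ty).
  move=> y' y yE; rewrite /sL; apply: (congr1 s); apply: val_inj.
  by rewrite /= yE addr0.
pose b := alT z 0 0 - 1 / 2.
have lp : local_expr (A := cylinder_atlas A) (@prism s L tau HL) z (j, b)
    (fun y => row_mx (alT y) ((u \o alL) y)).
  apply: (local_expr_cylinder openT I cT _ _ lu2); first by rewrite /b /alT; lra.
  by move=> y; rewrite addr0.
rewrite (pullback2_ext_d1 cc fbeta (rT 2) (smooth_prism _ _ ss) Tz).
rewrite (curl_pullback1 cc fbeta (rT 2) Tz lp).
have Dp := local_expr_dom lp Tz.
have [ O [oO Oz cu _]] := lu1; have du := is_Cinfty_differentiable cu Oz.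
have dL := is_Cinfty_differentiable cL (I : setT z).
have dT := is_Cinfty_differentiable cT (I : setT z).
have duL := differentiable_comp dL du.
have [ O' [oO' O'z cp _]] := lp; have dp := is_Cinfty_differentiable cp O'z.
have J1 := jacobian_comp dL du; rewrite jacobian_affine in J1.
have J2 := jacobian_row_mx dT duL dp; rewrite jacobian_affine J1 in J2.
rewrite J2 (ext_d1_block Dp) mul_row_block !mulmx0 !add0r.
rewrite tr_row_mx mul_row_col mul0mx add0r trmx_mul !mulmxA.
set Ju := jacobian u _; set W := drsubmx _.
have aW : W^T = - W.
  apply/matrixP => r l; rewrite [LHS]mxE [LHS]mxE [in LHS]mxE ext_d1_asym.
  by rewrite [RHS]mxE [in RHS]mxE [in RHS]mxE.
(* The pull-back of the two-form W by u, whose source has dimension one. *)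
have Z0 : Ju *m W *m Ju^T = 0.
  apply: antisymmetric_mx11.
  by rewrite !trmx_mul trmxK aW mulNmx mulmxN mulmxA.
by rewrite -(mulmxA L Ju W) -(mulmxA L) Z0 mulmx0 mul0mx.
Qed.

Definition level (s : @std_simplex R 1 -> S) (r : R) : R :=
  int_edge beta (fun t => (s t, r)).

Definition vertical (p : S) : R :=
  int_edge beta (fun t : @std_simplex R 1 => (p, \val t 0 0)).

Lemma mem0_itv01 : (0 : R) \in `[0, 1].
Proof. by rewrite in_itv/= lexx ler01. Qed.

Lemma mem1_itv01 : (1 : R) \in `[0, 1].
Proof. by rewrite in_itv/= lexx ler01. Qed.

Definition edge_start : @std_simplex R 1 := in_dom (simplex1P mem0_itv01).
Definition edge_end : @std_simplex R 1 := in_dom (simplex1P mem1_itv01).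

Lemma prism_edges s L tau HL : smooth_into A s ->
  int_edge beta (@prism s L tau HL \o face ord0)
  - int_edge beta (@prism s L tau HL \o face (lift ord0 ord0))
  + int_edge beta (@prism s L tau HL \o face (lift ord0 (lift ord0 ord0))) = 0.
Proof.
move=> ss; have cc := compatible_cylinder cA.
have := stokes cc fbeta (smooth_prism tau HL ss).
rewrite (sum_face_sign (fun i => int_edge beta (@prism s L tau HL \o face i))).
move=> <-.
rewrite /Rintegral integral0_eq// => p Tp.
by rewrite (pullback2_prism tau HL ss Tp) mxE.
Qed.

Lemma plane_pt_col (p : R * R) (L : 'cV[R]_2) :
  plane_pt p *m L = const_mx (p.1 * L ord0 0 + p.2 * L ord_max 0).
Proof.
apply/matrixP => i j; rewrite !mxE !big_ord_recl big_ord0 addr0 !mxE/= ord1.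
by congr (_ + _ * L _ _); exact: val_inj.
Qed.

Definition sum_col : 'cV[R]_2 := const_mx 1.
Definition second_col : 'cV[R]_2 := delta_mx ord_max 0.

Lemma plane_pt_sum_col p : plane_pt p *m sum_col = const_mx (p.1 + p.2).
Proof. by rewrite plane_pt_col !mxE !mulr1. Qed.

Lemma plane_pt_second_col p : plane_pt p *m second_col = const_mx p.2.
Proof. by rewrite plane_pt_col !mxE/= mulr0 add0r mulr1. Qed.

Lemma sum_col_simplex z : @std_simplex R 2 z -> @std_simplex R 1 (z *m sum_col).
Proof.
move=> [z0 z1]; split=> [i|].
  by rewrite mxE sumr_ge0// => l _; rewrite mxE mulr1.
rewrite big_ord_recl big_ord0 addr0 mxE.
by under eq_bigr do rewrite mxE mulr1.
Qed.

Lemma second_col_simplex z :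
  @std_simplex R 2 z -> @std_simplex R 1 (z *m second_col).
Proof.
move=> [z0 z1]; have zE : z *m second_col = const_mx (z 0 ord_max).
  by apply/matrixP => i j; rewrite !ord1 -colE !mxE.
rewrite zE; apply: simplex1P; rewrite in_itv/= z0/=; apply: le_trans z1.
by rewrite !big_ord_recl big_ord0 addr0 (_ : lift ord0 ord0 = ord_max) ?lerDr//;
  exact: val_inj.
Qed.

Lemma edge_eta (t : @std_simplex R 1) : \val t = const_mx (\val t 0 0).
Proof. by apply/matrixP => i j; rewrite !ord1 mxE. Qed.

Lemma prism_face s L tau HL i (t : @std_simplex R 1) (p : R * R)
    (q : @std_simplex R 1) (r : R) :
  face_pt i (const_mx (\val t 0 0)) = plane_pt p ->
  plane_pt p *m L = \val q -> (plane_pt p *m tau) 0 0 = r ->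
  (@prism s L tau HL \o face i) t = (s q, r).
Proof.
move=> pE qE rE; rewrite /prism /=; congr (s _, _).
  by apply: val_inj; rewrite /= edge_eta pE.
by rewrite edge_eta pE.
Qed.

(** The square s x [0, 1] is cut by its diagonal into the triangles with
    vertices (0, 0), (1, 0), (1, 1) and (0, 0), (0, 1), (1, 1), in coordinates
    (parameter, height).  The integral over the diagonal cancels between the two
    relations given by Stokes' formula. *)
Lemma level_homotopy s : smooth_into A s ->
  level s 1 - level s 0 = vertical (s edge_end) - vertical (s edge_start).
Proof.
move=> ss; have [_ f0] := @triangle_face0 R.
have [_ f1] := @triangle_face1 R; have [_ f2] := @triangle_face2 R.
have := prism_edges second_col sum_col_simplex ss.
have := prism_edges sum_col second_col_simplex ss.
pose diag (t : @std_simplex R 1) := (s t, \val t 0 0).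
set P2 := @prism s second_col _ _; set P1 := @prism s sum_col _ _.
have -> : P2 \o face ord0 = fun t => (s t, 1).
  apply/funext => t; apply: prism_face (f0 _) _ _.
    by rewrite plane_pt_second_col/= -edge_eta.
  by rewrite plane_pt_sum_col mxE/= subrK.
have -> : P2 \o face (lift ord0 ord0) = diag.
  apply/funext => t; apply: prism_face (f1 _) _ _.
    by rewrite plane_pt_second_col/= -edge_eta.
  by rewrite plane_pt_sum_col mxE/= add0r.
have -> : P2 \o face (lift ord0 (lift ord0 ord0)) =
    fun t => (s edge_start, \val t 0 0).
  apply/funext => t; apply: prism_face (f2 _) _ _.
    by rewrite plane_pt_second_col.
  by rewrite plane_pt_sum_col mxE/= addr0.
have -> : P1 \o face ord0 = fun t => (s edge_end, \val t 0 0).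
  apply/funext => t; apply: prism_face (f0 _) _ _.
    by rewrite plane_pt_sum_col/= subrK.
  by rewrite plane_pt_second_col mxE.
have -> : P1 \o face (lift ord0 ord0) = diag.
  apply/funext => t; apply: prism_face (f1 _) _ _.
    by rewrite plane_pt_sum_col/= add0r -edge_eta.
  by rewrite plane_pt_second_col mxE.
have -> : P1 \o face (lift ord0 (lift ord0 ord0)) = fun t => (s t, 0).
  apply/funext => t; apply: prism_face (f2 _) _ _.
    by rewrite plane_pt_sum_col/= addr0 -edge_eta.
  by rewrite plane_pt_second_col mxE.
rewrite -!/(level _ _) -!/(vertical _) => e2 e1.
have := congr2 (fun x y => x - y) e2 e1; rewrite /= subr0; lra.
Qed.

End Prism.

(** * Singular chains and the flux *)

Section ChainSums.
Context {R : realType} {M : topologicalType}.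

(** Two chains have different supports; their sums can be compared over a common
    list of simplices. *)
Lemma chain_sum_sub k (V : zmodType) (c : @chain R M k) F
    (X : seq (@std_simplex R k -> M)) : uniq X -> {subset dom c <= X} ->
  chain_sum c F = \sum_(s <- X) (F s : V) *~ coeff s c.
Proof.
move=> uX cX; rewrite [RHS](bigID (fun s => s \in dom c))/= [X in _ + X]big1.
  rewrite addr0 -big_filter; apply: perm_big; apply: uniq_perm.
  - exact: uniq_dom.
  - exact: filter_uniq.
  - by move=> s; rewrite mem_filter; case: (boolP (s \in dom c)) => // /cX ->.
by move=> s sc; rewrite (coeff_outdom sc) mulr0z.
Qed.

Section Additive.
Context {k : nat} {V : zmodType} (F : (@std_simplex R k -> M) -> V).

(** The value chain_sum c F as a function of c, in order to declare it
    additive. *)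
Definition chain_map (c : @chain R M k) : V := chain_sum c F.

Fact chain_map_is_zmod_morphism : zmod_morphism chain_map.
Proof.
move=> c d; pose X := undup (dom c ++ dom d ++ dom (c - d)).
have uX : uniq X by exact: undup_uniq.
have cX : {subset dom c <= X} by move=> s sd; rewrite mem_undup !mem_cat sd.
have dX : {subset dom d <= X} by move=> s sd; rewrite mem_undup !mem_cat sd orbT.
have bX : {subset dom (c - d) <= X}.
  by move=> s sd; rewrite mem_undup !mem_cat sd !orbT.
rewrite /chain_map (chain_sum_sub F uX cX) (chain_sum_sub F uX dX).
rewrite (chain_sum_sub F uX bX) -sumrB.
by apply: eq_bigr => s _; rewrite coeffB mulrzBr.
Qed.
HB.instance Definition _ :=
  GRing.isZmodMorphism.Build (@chain R M k) V chain_map chain_map_is_zmod_morphism.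

Lemma chain_map1 s : chain_map << s >> = F s.
Proof.
by rewrite /chain_map /chain_sum domU1 big_seq1 coeffU eqxx mulr1 mulr1z.
Qed.

End Additive.

Lemma chain_map_bnd k (V : zmodType) (F : (@std_simplex R k -> M) -> V) c :
  chain_map F (bnd c)
  = chain_sum c (fun s => \sum_(i < k.+2) F (s \o face i) *~ (-1) ^+ i).
Proof.
rewrite /bnd /chain_sum raddf_sum; apply: eq_bigr => s _.
rewrite raddfMz raddf_sum; congr (_ *~ _); apply: eq_bigr => i _.
by rewrite raddfMz/= chain_map1.
Qed.

Lemma chain_map_push k (V : zmodType) (F : (@std_simplex R k -> M) -> V) h c :
  chain_map F (push h c) = chain_sum c (fun s => F (h \o s)).
Proof.
rewrite /push /chain_sum raddf_sum; apply: eq_bigr => s _.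
by rewrite raddfMz/= chain_map1.
Qed.

End ChainSums.

Lemma simplex0 (R : realType) : @std_simplex R 0 0.
Proof. by split=> [i|]; [rewrite mxE|rewrite big_ord0 ler01]. Qed.

Lemma face_pt_vertex (R : realType) (i : 'I_2) :
  face_pt i (0 : 'rV[R]_0) = vertex (lift i ord0).
Proof.
rewrite /face_pt big_ord_recl big_ord0 addr0 /bary unlift_none big_ord0.
by rewrite subr0 scale1r.
Qed.

Lemma face_end (R : realType) : face ord0 (in_dom (simplex0 R)) = edge_end.
Proof.
apply: val_inj; rewrite /= face_pt_vertex vertex_lift.
by apply/rowP => j; rewrite !mxE ord1.
Qed.

Lemma face_start (R : realType) :
  face (lift ord0 ord0) (in_dom (simplex0 R)) = edge_start.
Proof.
apply: val_inj; rewrite /= face_pt_vertex.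
rewrite (_ : lift _ _ = ord0); last exact: val_inj.
by rewrite vertex0; apply/rowP => j; rewrite !mxE.
Qed.

Section FluxIntegral.
Context {R : realType} {n : nat} {S : topologicalType} {A : atlas R n S}.
Context (beta : pre_form1 (cylinder_atlas A)) (w : pre_form2 A).
Context (h : S -> S) (e : R).
Hypotheses (cA : compatible_charts A) (fbeta : is_form1 beta) (e0 : e != 0).
Hypothesis vert : forall (ia : pidx (cylinder_atlas A)) y, pdom ia y ->
  forall l, ext_d1 beta ia y (lshift n ord0) l = 0.
Hypothesis horizontal : forall (i : pidx A) x, pdom i x ->
  drsubmx (ext_d1 beta ((i, - (1 / 2)) : pidx (cylinder_atlas A)) (row_mx 0 x))
  = e *: w i x.
Hypothesis deck_level : forall s : @std_simplex R 1 -> S, smooth_into A s ->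
  level beta s 1 = level beta (h \o s) 0.
Local Notation mu := (@lebesgue_measure R).
Local Notation mu2 := (mu \x mu)%E.

Lemma smooth_slice k (D : set 'rV[R]_k) (f : D -> S) (t : R) : smooth_into A f ->
  smooth_into (cylinder_atlas A) (fun y => (f y, t)).
Proof.
apply: (smooth_into_cylinder (tau := fun _ => const_mx t)) => [r|y].
  exact: is_Ck_cst openT.
by rewrite /curl mxE.
Qed.

(** The two-form w enters only through its values, and the right-hand side is
    computed from some local expression of s; the left-hand side shows that
    all local expressions give the same value. *)
Lemma pullback2_slice k (D : set 'rV[R]_k) (s : D -> S) z :
  regular_dom D -> smooth_into A s -> D z ->
  pullback2 (fun y => (s y, 0 : R)) (ext_d1 beta) z = e *: pullback2 s w z.
Proof.
move=> rD ss Dz; have cc := compatible_cylinder cA.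
rewrite (pullback2_ext_d1 cc fbeta rD (smooth_slice 0 ss) Dz).
have [j0 [u0 lu0]] := ss z Dz; rewrite [in RHS]/pullback2.
have : [set B | exists (j : pidx A) u, local_expr s z j u /\
    B = jacobian u z *m w j (u z) *m (jacobian u z)^T]
    (jacobian u0 z *m w j0 (u0 z) *m (jacobian u0 z)^T) by exists j0, u0.
move=> /getI[j [u [lu ->]]].
have cT : is_Cinfty setT (fun y : 'rV[R]_k => y *m (0 : 'M[R]_(k, 1)) + 0).
  exact: is_Cinfty_affine openT.
have lp : local_expr (A := cylinder_atlas A) (fun y => (s y, 0 : R)) z (j, - (1 / 2))
    (fun y => row_mx (y *m (0 : 'M[R]_(k, 1)) + 0) (u y)).
  apply: (local_expr_cylinder openT I cT _ _ lu).
    by rewrite mulmx0 addr0 mxE; lra.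
  by move=> y; rewrite mulmx0 addr0 mxE.
rewrite (curl_pullback1 cc fbeta rD Dz lp).
have [ O [oO Oz cu _]] := lu; have du := is_Cinfty_differentiable cu Oz.
have [ O' [oO' O'z cp _]] := lp; have dp := is_Cinfty_differentiable cp O'z.
have dT := is_Cinfty_differentiable cT (I : setT z).
have J2 := jacobian_row_mx dT du dp; rewrite jacobian_affine in J2.
rewrite J2 (ext_d1_block vert (local_expr_dom lp Dz)).
rewrite mul_row_block !mulmx0 !add0r tr_row_mx mul_row_col mul0mx add0r.
rewrite (horizontal (local_expr_dom lu Dz)).
by rewrite -scalemxAr -scalemxAl.
Qed.

(** Stokes' formula in the slice of height 0, where e w is the restriction of
    d beta. *)
Lemma int_simplex_level s : smooth_into A s ->
  e * int_simplex w s = \sum_(i < 3) level beta (s \o face i) 0 *~ (-1) ^+ i.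
Proof.
move=> ss; have cc := compatible_cylinder cA; have rT := @regular_simplex R 2.
rewrite -[RHS](stokes cc fbeta (smooth_slice 0 ss)).
pose f (p : R * R) : R := pullback2 (fun y => (s y, 0 : R)) (ext_d1 beta)
  (plane_pt p) ord0 ord_max.
have cf : {within triangle, continuous f}.
  pose b := pullback1 beta (fun y : @std_simplex R 2 => (s y, 0 : R)).
  have sb : smooth_within (@std_simplex R 2) b.
    exact: smooth_pullback1 cc fbeta rT (smooth_slice 0 ss).
  have cc2 := curl_entry_continuous (k := ord0) (l := ord_max) rT sb.
  have c2 : {within triangle,
      continuous ((fun z => curl (@std_simplex R 2) b z ord0 ord_max) \o plane_pt)}.
    apply: within_continuous_compr cc2; first exact: plane_pt_continuous.
    by move=> p; rewrite -simplex2E.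
  have fE p : triangle p ->
      f p = curl (@std_simplex R 2) b (plane_pt p) ord0 ord_max.
    rewrite -simplex2E /f => Tp.
    by rewrite (pullback2_ext_d1 cc fbeta rT (smooth_slice 0 ss) Tp).
  by apply: subspace_eq_continuous c2 => p /set_mem Tp; exact: esym (fE p Tp).
have intf := integrable_triangle cf.
rewrite /int_simplex simplex2E.
(* Dividing by e expresses the integrand through f, which is known to be
   integrable as a continuous function on the triangle. *)
transitivity (e * \int[mu2]_(p in triangle) (e^-1 * f p)); last first.
  by rewrite RintegralZl ?mulVKf//; exact: measurable_triangle.
congr (_ * _); apply: eq_Rintegral => p; rewrite inE -simplex2E => Tp.
by rewrite /f (pullback2_slice rT ss Tp) mxE mulKf.
Qed.

(** The boundary h(c) - c of C is integrated against beta_0; by the deck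
    identification this is the difference of the integrals of beta_1 and
    beta_0 over c, which is the integral of the function vertical over the
    boundary of c, that is, zero. *)
Lemma flux_integral_eq0 (c : @chain R S 1) (C : @chain R S 2) :
  smooth_cycle A c -> smooth_chain A C -> bnd C = push h c - c ->
  int_chain w C = 0.
Proof.
move=> [sc bc] sC bC; apply: (mulfI e0); rewrite mulr0.
pose F0 := fun s => level beta s 0.
transitivity (chain_map F0 (bnd C)).
  rewrite chain_map_bnd /int_chain /chain_sum mulr_sumr.
  rewrite big_seq [RHS]big_seq; apply: eq_bigr => s sC'.
  by rewrite mulrzAr (int_simplex_level (sC s sC')).
rewrite bC raddfB/= chain_map_push /chain_map.
pose V0 (p : @std_simplex R 0 -> S) := vertical beta (p (in_dom (simplex0 R))).
transitivity (chain_map V0 (bnd c)); last by rewrite bc raddf0.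
rewrite chain_map_bnd /chain_sum -sumrB big_seq [RHS]big_seq.
apply: eq_bigr => s sc'; rewrite -mulrzBl; congr (_ *~ _).
rewrite /F0 -(deck_level (sc s sc')) (level_homotopy cA fbeta vert (sc s sc')).
rewrite !big_ord_recl big_ord0 addr0 expr0 expr1 mulr1z mulrN1z.
by rewrite /V0 /= face_end face_start.
Qed.

End FluxIntegral.

(** * One-forms on the mapping torus *)

Section Torus.
Context {R : realType} {S : topologicalType} (h : S -> S).
Context {n : nat} {A : atlas R n S}.
Local Open Scope quotient_scope.

Lemma iter_deckE a (p : S * R) :
  iter a (deck h) p = (iter a h p.1, p.2 - a%:R).
Proof.
elim: a => [|a IH] /=; first by rewrite subr0; case: p.
by rewrite IH /deck /= -addrA -opprD natr1.
Qed.

(** The iterates of the deck transformation are computed explicitly, which turns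
    the equivalence into an equation in S and an equation between heights. *)
Lemma torus_piP (p q : S * R) :
  torus_pi h p = torus_pi h q <->
  exists a b : nat, iter a h p.1 = iter b h q.1 /\ p.2 - a%:R = q.2 - b%:R.
Proof.
have -> : torus_pi h p = torus_pi h q <-> torus_rel h p q.
  by split=> [/eqmodP//|?]; exact/eqmodP.
split=> [/asboolP[a [b]]|[a [b [e1 e2]]]].
  by rewrite !iter_deckE => -[e1 e2]; exists a, b.
by apply/asboolP; exists a, b; rewrite !iter_deckE e1 e2.
Qed.

Lemma local_expr_torus k (D : set 'rV[R]_k) (f : D -> S * R) x
    (ia : pidx (cylinder_atlas A)) u :
  local_expr f x ia u ->
  local_expr (A := torus_atlas h A) (torus_pi h \o f) x ia u.
Proof.
move=> [ O [oO Ox cu fu]]; exists O; split => // y Oy.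
by have [Dy E] := fu y Oy; split => //=; rewrite -E.
Qed.

Lemma form1_torus_cylinder (a : pre_form1 (torus_atlas h A)) :
  is_form1 a -> is_form1 (a : pre_form1 (cylinder_atlas A)).
Proof.
move=> [sa ta]; split=> [ia|ia x ja u Dx lu]; first exact: sa.
by apply: ta => //; exact: local_expr_torus lu.
Qed.

(** A change of the height by a constant d is compatible with the projection to
    the mapping torus when v expresses the corresponding power of h; the map
    is then a transition between two charts of the mapping torus. *)
Lemma local_expr_shift (i j : pidx A) (b c : R) (d : R) (y : 'rV[R]_(1 + n)) v
    (O : set 'rV[R]_n) :
  open O -> O (rsubmx y) -> is_Cinfty O v ->
  c < lsubmx y 0 0 + d < c + 1 ->
  (forall z, O z -> pdom i z -> pdom j (v z)) ->
  (forall z t, O z -> pdom i z ->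
     torus_pi h (par j (v z), t + d) = torus_pi h (par i z, t)) ->
  local_expr (A := torus_atlas h A)
    (par_on ((i, b) : pidx (torus_atlas h A))) y (j, c)
    (fun z : 'rV[R]_(1 + n) => row_mx (lsubmx z + const_mx d) (v (rsubmx z))).
Proof.
move=> oO Oy cv wy vE pE.
have oO1 : open (setT `&` @rsubmx R 1 1 n @^-1` O).
  have cr := @is_Cinfty_rsubmx R 1 n setT openT.
  exact: open_setI_preimage openT oO (fun z _ => is_Cinfty_continuous cr (I : setT z)).
have cl : is_Cinfty setT (fun z : 'rV[R]_(1 + n) => lsubmx z + const_mx d).
  move=> r; apply: is_CkD; first exact: openT.
    exact: (@is_Cinfty_lsubmx R 1 n setT openT r).
  exact: is_Ck_cst openT.
pose O' := (setT `&` @rsubmx R 1 1 n @^-1` O) `&`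
  [set z | c < (lsubmx z + const_mx d) 0 0 < c + 1].
have oO' : open O'.
  by apply: open_window => //; apply: is_Cinfty_sub cl.
exists O'; split => //.
- by split => //=; rewrite [_ 0 0]mxE [const_mx _ _ _]mxE.
- move=> r; apply: is_Ck_row_mx => //; first exact: is_Ck_sub (cl r).
  apply: (is_Ck_comp_mx (O' := O)) => //; first by move=> z [[]].
  exact: is_Ck_sub (@is_Cinfty_rsubmx R 1 n setT openT r).
move=> z [[_ /= Oz] wz]; have [Dz _] := set_valP z.
rewrite row_mxKl row_mxKr; split; first by split => //; exact: vE.
by rewrite [_ 0 0]mxE [const_mx _ _ _]mxE pE.
Qed.

Section Deck.
Context (beta : pre_form1 (torus_atlas h A)).
Hypotheses (cA : compatible_charts A) (fbeta : is_form1 beta).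
Hypothesis sh : smooth_map A A h.

(** The points (p, 1) and (h(p), 0) of the cylinder have the same image in the
    mapping torus, and (z, t) |-> (h(z), t - 1) is there a change of charts. *)
Lemma pullback1_deck k (D : set 'rV[R]_k) (s : D -> S) x :
  regular_dom D -> smooth_into A s -> D x ->
  pullback1 (beta : pre_form1 (cylinder_atlas A)) (fun y => (s y, 1 : R)) x
  = pullback1 (beta : pre_form1 (cylinder_atlas A)) (fun y => ((h \o s) y, 0 : R)) x.
Proof.
move=> rD ss Dx; have cc := compatible_cylinder cA.
have fc := form1_torus_cylinder fbeta.
have [j [u lu]] := ss x Dx; have Du := local_expr_dom lu Dx.
have [l [v lv]] := sh Du.
have lhs := local_expr_map Dx lu lv.
have c1 r : is_Cinfty setT (fun _ : 'rV[R]_k => const_mx r : 'rV[R]_1).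
  by move=> q; exact: is_Ck_cst openT.
have l1 : local_expr (A := cylinder_atlas A) (fun y => (s y, 1 : R)) x (j, 1 / 2)
    (fun y => row_mx (const_mx 1) (u y)).
  apply: (local_expr_cylinder openT I (c1 1) _ _ lu) => [|y]; last by rewrite mxE.
  by rewrite mxE; lra.
have l2 : local_expr (A := cylinder_atlas A) (fun y => ((h \o s) y, 0 : R)) x
    (l, - (1 / 2)) (fun y => row_mx (const_mx 0) ((v \o u) y)).
  apply: (local_expr_cylinder openT I (c1 0) _ _ lhs) => [|y]; last by rewrite mxE.
  by rewrite mxE; lra.
rewrite (pullback1E cc fc rD Dx l1) (pullback1E cc fc rD Dx l2).
have [ O [oO Ox cv fv]] := lv.
(* The change of charts (t, z) |-> (t - 1, v z), where v expresses h. *)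
pose Psi (z : 'rV[R]_(1 + n)) := row_mx (lsubmx z + const_mx (- 1)) (v (rsubmx z)).
pose w1 y := row_mx (const_mx 1 : 'rV[R]_1) (u y).
have lPsi : local_expr (A := torus_atlas h A)
    (par_on ((j, 1 / 2) : pidx (torus_atlas h A))) (w1 x) (l, - (1 / 2)) Psi.
  apply: (local_expr_shift _ oO) => //.
  - by rewrite row_mxKr.
  - by rewrite row_mxKl mxE; lra.
  - by move=> z Oz Dz; case: (fv (in_dom Dz) Oz).
  - move=> z t Oz Dz; apply/torus_piP; exists 0%N, 1%N => /=; split.
      by case: (fv (in_dom Dz) Oz).
    by rewrite subr0.
have Dw1 : pdom (a := torus_atlas h A) (j, 1 / 2) (w1 x).
  exact: local_expr_dom l1 Dx.
have PsiE : Psi \o w1 = fun y => row_mx (const_mx 0) ((v \o u) y).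
  apply/funext => y; rewrite /Psi /w1 /= row_mxKl row_mxKr; congr row_mx.
  by apply/rowP => q; rewrite !mxE subrr.
have fE := fbeta.2 _ _ _ _ Dw1 lPsi.
have [ O1 [oO1 O1x cw1 _]] := l1; have dw1 := is_Cinfty_differentiable cw1 O1x.
have [ O2 [oO2 O2x cPsi _]] := lPsi; have dPsi := is_Cinfty_differentiable cPsi O2x.
have JE := jacobian_comp dw1 dPsi; rewrite PsiE in JE.
have PE : Psi (w1 x) = row_mx (const_mx 0) ((v \o u) x).
  exact: (congr1 (fun F => F x) PsiE).
rewrite -/(w1 x) fE PE.
apply: etrans (mulmxA _ _ _) _.
exact: (congr1 (mulmx ^~ (beta (l, - (1 / 2)) (row_mx (const_mx 0) ((v \o u) x))))
  (esym JE)).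
Qed.

Lemma deck_level (s : @std_simplex R 1 -> S) : smooth_into A s ->
  level (beta : pre_form1 (cylinder_atlas A)) s 1
  = level (beta : pre_form1 (cylinder_atlas A)) (h \o s) 0.
Proof.
move=> ss; apply: eq_Rintegral => t /set_mem t01.
have E := pullback1_deck (@regular_simplex R 1) ss (simplex1P t01).
exact: (congr1 (fun M : 'cV[R]_1 => M 0 0) E).
Qed.

(** Every two-chain that bounds h(c) - c has integral zero, so the flux of each
    cycle in the kernel is the trivial coset. *)
Theorem flux_eq0_of_primitive (w : pre_form2 A) (e : R) : e != 0 ->
  (forall (ia : pidx (torus_atlas h A)) y, pdom ia y ->
     forall l, ext_d1 beta ia y (lshift n ord0) l = 0) ->
  (forall (i : pidx A) x, pdom i x ->
     drsubmx (ext_d1 beta ((i, - (1 / 2)) : pidx (torus_atlas h A)) (row_mx 0 x))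
     = e *: w i x) ->
  ~ flux_nonzero w h.
Proof.
move=> e0 vert hor [c [cc [C0 sC0 bC0]] neq]; apply: neq.
have fl := flux_integral_eq0 cA (form1_torus_cylinder fbeta) e0 vert hor deck_level.
apply/seteqP; split=> [r [C [sC bC]]|r pr].
  by rewrite (fl c C cc sC bC) subr0.
by exists C0; split => //; rewrite (fl c C0 cc sC0 bC0) subr0.
Qed.

End Deck.
End Torus.

(** * De Rham classes and first return maps *)

Section Slice.
Context {R : realType} {S : topologicalType} (h : S -> S).
Context {n : nat} {A : atlas R n S}.
Context (alpha : pre_form1 (torus_atlas h A)).
Hypotheses (cA : compatible_charts A) (falpha : is_form1 alpha).

Lemma ext_d1_transition (ia ja : pidx (torus_atlas h A)) y Phi : pdom ia y ->
  local_expr (par_on ia) y ja Phi ->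
  ext_d1 alpha ia y
  = jacobian Phi y *m ext_d1 alpha ja (Phi y) *m (jacobian Phi y)^T.
Proof.
move=> Dy lPhi; have [rc _ _] := compatible_cylinder cA.
have [ O [oO Oy cPhi fPhi]] := lPhi.
have lz z : O z -> local_expr (par_on ia) z ja Phi by move=> Oz; exists O.
apply: (curl_pullback (rc ia) (rc ja) oO cPhi _ (falpha.1 ja) _ Oy Dy).
  by move=> z Oz Dz; exact: local_expr_dom (lz z Oz) Dz.
by move=> z Oz Dz; exact: falpha.2 (lz z Oz).
Qed.

(** Both l and c are integers, and an open interval of length 1 contains at most
    one integer. *)
Lemma integer_window (a l c : R) (p q p' q' : nat) :
  a < l < a + 1 -> a < c < a + 1 ->
  l - p%:R = 0 - q%:R -> c - p'%:R = 0 - q'%:R -> l = c.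
Proof.
move=> /andP[al la] /andP[ac ca] lE cE.
(* l = p - q and c = p' - q' are compared through sums of natural numbers. *)
have N1 : ((p + q')%N%:R : R) < (p' + q)%N.+1%:R by rewrite -natr1 !natrD; lra.
have N2 : ((p' + q)%N%:R : R) < (p + q')%N.+1%:R by rewrite -natr1 !natrD; lra.
have N3 : ((p + q')%N%:R : R) = (p' + q)%N%:R.
  congr _%:R; apply/eqP; rewrite eqn_leq; move: N1 N2.
  by rewrite !ltr_nat !ltnS => -> ->.
by move: N3; rewrite !natrD; lra.
Qed.

(** Restriction of a two-form to a slice of constant height. *)
Lemma mx_slice (W : 'M[R]_(1 + n)) :
  row_mx 0 1%:M *m W *m (row_mx 0 1%:M)^T = drsubmx W.
Proof.
rewrite -{1}[W](@submxK _ 1 n 1 n) mul_row_block !mul0mx !mul1mx !add0r.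
by rewrite tr_row_mx mul_row_col trmx0 mulmx0 trmx1 mulmx1 add0r.
Qed.

Lemma mx_first_row (W : 'M[R]_(1 + n)) l :
  (row_mx 1%:M 0 *m W) 0 l = W (lshift n ord0) l.
Proof.
rewrite -{1}[W](@vsubmxK _ 1 n) mul_row_col mul1mx mul0mx addr0 mxE.
by congr (W _ _); exact: val_inj.
Qed.

(** The left-hand side is the pull-back of d alpha to the slice of height 0 by
    an arbitrary local expression u.  In the chart where u takes its values,
    the slice has a constant integral height c, and the horizontal part v of u
    expresses a power of h.  Then (t, z) |-> (t + c, v z) is a transition to
    that chart from the chart of height around 0, so that no other description
    of the powers of h is required. *)
Lemma slice_ext_d1 (i : pidx A) x (ka : pidx (torus_atlas h A)) u : pdom i x ->
  local_expr (fun y => torus_pi h (par_on i y, 0 : R)) x ka u ->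
  jacobian u x *m ext_d1 alpha ka (u x) *m (jacobian u x)^T
  = drsubmx (ext_d1 alpha ((i, - (1 / 2)) : pidx (torus_atlas h A)) (row_mx 0 x)).
Proof.
case: ka => k a Dx lu; have [ O [oO Ox cu fu]] := lu.
have [rA _ _] := cA.
pose c := lsubmx (u x) 0 0.
have fu' y : O y -> pdom i y -> [/\ pdom k (rsubmx (u y)),
    a < lsubmx (u y) 0 0 < a + 1 & exists p q : nat,
    iter p h (par k (rsubmx (u y))) = iter q h (par i y) /\
    lsubmx (u y) 0 0 - p%:R = 0 - q%:R].
  move=> Oy Dy; have [[D1 D2] pE] := fu (in_dom Dy) Oy; split => //.
  by have /torus_piP := pE.
have uc y : O y -> pdom i y -> lsubmx (u y) 0 0 = c.
  move=> Oy Dy; have [_ wy [p [q [_ pq]]]] := fu' y Oy Dy.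
  have [_ wx [p' [q' [_ pq']]]] := fu' x Ox Dx.
  exact: integer_window wy wx pq pq'.
pose v z := rsubmx (u z).
have cv : is_Cinfty O v.
  move=> r; apply: (is_Ck_comp_mx (O' := setT)) => //; first exact: openT.
  exact: (@is_Cinfty_rsubmx R 1 n setT openT r).
pose Phi (z : 'rV[R]_(1 + n)) := row_mx (lsubmx z + const_mx c) (v (rsubmx z)).
have lPhi : local_expr (A := torus_atlas h A)
    (par_on ((i, - (1 / 2)) : pidx (torus_atlas h A))) (row_mx 0 x) (k, a) Phi.
  apply: (local_expr_shift _ oO) => //.
  - by rewrite row_mxKr.
  - by rewrite row_mxKl mxE add0r; case: (fu' x Ox Dx).
  - by move=> z Oz Dz; case: (fu' z Oz Dz).
  move=> z t Oz Dz; have [_ _ [p [q [pqE pq]]]] := fu' z Oz Dz.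
  apply/torus_piP; exists p, q; split => //=.
  by move: pq; rewrite (uc z Oz Dz); lra.
have D0 : pdom (a := torus_atlas h A) (i, - (1 / 2)) (row_mx 0 x).
  by split; rewrite /= ?row_mxKr// row_mxKl mxE; lra.
have c0 := is_Cinfty_affine (row_mx 0 1%:M : 'M[R]_(n, 1 + n)) 0
  (openT : open [set: 'rV[R]_n]).
have u0E y : y *m (row_mx 0 1%:M : 'M[R]_(n, 1 + n)) + 0 = row_mx 0 y.
  by rewrite addr0 mul_mx_row mulmx0 mulmx1.
have [ O2 [oO2 O2y cPhi _]] := lPhi.
pose u0 (y : 'rV[R]_n) := y *m (row_mx 0 1%:M : 'M[R]_(n, 1 + n)) + 0.
have oO3 : open (O `&` u0 @^-1` O2).
  exact: open_setI_preimage oO oO2 (fun y _ => is_Cinfty_continuous c0 (I : setT y)).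
have O3x : (O `&` u0 @^-1` O2) x by split => //=; rewrite /u0 u0E.
have uPhi y : (O `&` u0 @^-1` O2) y -> pdom i y -> u y = (Phi \o u0) y.
  move=> [Oy _] Dy; rewrite /Phi /= /u0 u0E row_mxKl row_mxKr add0r.
  rewrite -[LHS]hsubmxK; congr row_mx; apply/rowP => j.
  by rewrite ord1 [RHS]mxE uc.
have cPhi0 : is_Cinfty (O `&` u0 @^-1` O2) (Phi \o u0).
  move=> r; apply: (is_Ck_comp_mx (O' := O2)) => //; first by move=> y [].
  exact: is_Ck_sub (c0 r).
have cu3 : is_Cinfty (O `&` u0 @^-1` O2) u by apply: is_Cinfty_sub cu => y [].
have J1 := jacobian_unique (rA i) Dx oO3 O3x cu3 cPhi0 uPhi.
have du0 := is_Cinfty_differentiable c0 (I : setT x).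
have dPhi : differentiable Phi (u0 x).
  by rewrite /u0 u0E; exact: is_Cinfty_differentiable cPhi O2y.
have J2 := jacobian_comp du0 dPhi.
rewrite J2 jacobian_affine in J1.
have ux : u x = Phi (u0 x) by rewrite (uPhi x).
rewrite J1 ux -/(u0 x) [in LHS]/u0 u0E trmx_mul -mx_slice.
rewrite (ext_d1_transition D0 lPhi).
by rewrite !mulmxA.
Qed.

End Slice.

Section ZeroForm.
Context {R : realType} {n : nat} {M : Type} {A : atlas R n M}.
Hypothesis rA : forall i : pidx A, regular_dom (pdom i).

Lemma smooth_within_cst (V W : normedModType R) (D : set V) (a : W) :
  smooth_within D (fun=> a).
Proof.
move=> x _; exists (fun=> a); exists setT; split => //; first exact: openT.
by move=> k; exact: is_Ck_cst openT.
Qed.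

Lemma derive_within_cst (V W : normedModType R) (D : set V) (a : W) x v :
  regular_dom D -> D x -> derive_within D (fun=> a) x v = 0.
Proof.
move=> rD Dx.
have aE : smooth_extension D (fun=> a) x (fun=> a).
  exists setT; split => //; first exact: openT.
  by move=> k; exact: is_Ck_cst openT.
by rewrite (derive_withinE v rD Dx aE); exact: derive_cst.
Qed.

Lemma zero_in_deRham_zero : deRham_zero A (fun _ _ => 0).
Proof.
split.
- split=> [i|i x _|i x j u _ _]; first exact: smooth_within_cst.
    by rewrite trmx0 oppr0.
  by rewrite mulmx0 mul0mx.
- by move=> i x k l m Dx; rewrite !derive_within_cst ?addr0.
- exists (fun _ _ => 0) => [|i x Dx].
    by split=> [i|i x j u _ _]; [exact: smooth_within_cst|rewrite mulmx0].
  apply/matrixP => k l; rewrite subr0 [LHS]mxE [RHS]mxE.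
  by rewrite !derive_within_cst ?subr0.
Qed.

End ZeroForm.

Theorem lemma2p2 (R : realType) (m : nat) (S : topologicalType)
    (A : atlas R m.*2 S) (w : pre_form2 A) (h : S -> S)
    (S_manifold : manifold_with_boundary A)
    (S_compact : compact [set: S])
    (w_symplectic : symplectic w)
    (h_symplecto : symplectomorphism w h)
    (w_exact : is_exact2 w)
    (flux_h : flux_nonzero w h) :
  deRham_class (omega_torus h w) <> deRham_zero (torus_atlas h A) /\
  ~ first_return_of_reeb w h.
Proof.
have cA := manifold_compatible S_manifold.
have [rc _ _] := compatible_cylinder cA.
have [sh _ _] := h_symplecto.
split=> [cl|[alpha [X [[falpha _] slice [_ reeb] [g g0 XE]]]]].
  have : deRham_class (omega_torus h w) (fun _ _ => 0).
    by rewrite cl; exact: zero_in_deRham_zero.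
  move=> [_ _ [a fa aE]].
  apply: (flux_eq0_of_primitive (e := - 1) cA fa sh _ _ _ flux_h)
    => [|ia y Dy l|i x Dx].
  - by rewrite oppr_eq0 oner_eq0.
  - rewrite -aE// sub0r /omega_torus [LHS]mxE /block_mx col_mxEu row_mx0 mxE.
    exact: oppr0.
  rewrite -aE; last by split; rewrite /= ?row_mxKr// row_mxKl mxE; lra.
  rewrite sub0r /omega_torus /= row_mxKr scaleN1r.
  by rewrite opp_block_mx block_mxKdr.
apply: (flux_eq0_of_primitive (e := 1) cA falpha sh _ _ _ flux_h)
  => [|ia y Dy l|i x Dx].
- exact: oner_neq0.
- have [_ /matrixP/(_ 0 l)] := reeb ia y Dy.
  rewrite XE// -scalemxAl [LHS]mxE [RHS]mxE => /eqP.
  rewrite mulf_eq0 gt_eqF//= => /eqP.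
  by move=> dW; rewrite -(mx_first_row (n := m.*2)); exact: dW.
rewrite scale1r -(slice i x Dx) /pullback2.
(* The inclusion of the slice is expressed in the chart by x |-> (0, x); so
   pullback2 is the value given by some local expression. *)
have ex : exists u, local_expr (A := torus_atlas h A)
    (fun y => torus_pi h (par_on i y, 0 : R)) x (i, - (1 / 2)) u.
  pose f (y : pdom i) := (par_on i y, 0 : R).
  have lid : local_expr (par_on i) x i id.
    exists setT; split => //; first exact: openT.
      by move=> r; apply: (@is_Ck_linear R r _ _ setT
        (idfun : {linear 'rV[R]_m.*2 -> 'rV[R]_m.*2})) => [|z];
        [exact: openT|exact: cvg_id].
    by move=> y _; split => //; exact: set_valP.
  exists (fun y => row_mx (const_mx 0) y).
  apply: (@local_expr_torus R S h m.*2 A _ _ f).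
  apply: (local_expr_cylinder (tau := fun=> const_mx 0) openT I _ _ _ lid).
  - by move=> r; exact: is_Ck_cst openT.
  - by rewrite mxE; lra.
  - by move=> y; rewrite mxE.
have [u0 lu0] := ex.
have : [set B | exists (j : pidx (torus_atlas h A)) u,
    local_expr (fun y => torus_pi h (par_on i y, 0 : R)) x j u /\
    B = jacobian u x *m ext_d1 alpha j (u x) *m (jacobian u x)^T]
    (jacobian u0 x *m ext_d1 alpha (i, - (1 / 2)) (u0 x) *m (jacobian u0 x)^T).
  by exists (i, - (1 / 2)), u0.
by move=> /getI[ka [u [lu ->]]]; exact: esym (slice_ext_d1 cA falpha Dx lu).
Qed.
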